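(* Let $\mathcal{G}$ be a planar lattice graph, invariant under the lattice $\Lambda\cong\mathbb{Z}^2$, such that $G=\mathcal{G}/\Lambda$ and its dual $G^*$ on the torus are $2$-connected, all their faces are topological disks, and each edge of $G$ intersects its dual edge exactly once and intersects no other edge of $G^*$. Let $s\geq2$ be an integer, and let $\mathcal{G}_s$ be the planar lattice graph obtained from $\mathcal{G}$ by replacing every edge by $s$ parallel edges. If $$\nu^{\lozenge}(\mathcal{G})\leq2\pi z_{\mathcal{G}}\leq\overline{\nu}(\mathcal{G}),$$ then $$\nu^{\lozenge}(\mathcal{G}_s)<2\pi z_{\mathcal{G}_s}<\overline{\nu}(\mathcal{G}_s).$$
   Context: A planar lattice graph $\mathcal{G}$ is a connected locally finite planar graph (multiple edges allowed) embedded in $\mathbb{R}^2$ that is invariant under the translation action of a lattice $\Lambda\cong\mathbb{Z}^2$; $G=\mathcal{G}/\Lambda$ is the quotient graph on the torus $T^2=\mathbb{R}^2/\Lambda$, with vertex, edge and face sets $VG,EG,FG$, and $G^*$ is its dual graph on $T^2$. When an edge is replaced by $s$ parallel edges, these are drawn next to each other so that consecutive ones bound bigon faces. Spanning tree entropy: $z_{\mathcal{G}}=\lim_{n\to\infty}\frac{\log\tau(\Gamma_n)}{|V\Gamma_n|}$, where $\Gamma_n$ is the exhaustive nested sequence of finite connected planar graphs given by $n\times n$ copies of the $\Lambda$-fundamental domain of $\mathcal{G}$, $\tau$ is the number of spanning trees, and $V\Gamma_n$ is the vertex set. Bipyramid volume: Let $L(\theta)=-\int_0^\theta\log|2\sin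 t|\,dt$, and let $B_n$ ($n\ge 2$) be the hyperbolic regular ideal bipyramid over an $n$-gon, with $\mathrm{vol}(B_n)=2n\,L(\pi/n)$ (so $\mathrm{vol}(B_2)=0$). With $|f|$ the degree of a face $f$, $\mathrm{vol}^{\lozenge}(G)=\sum_{f\in FG}\mathrm{vol}(B_{|f|})$, and $\nu^{\lozenge}(\mathcal{G})=\frac{\mathrm{vol}^{\lozenge}(G)+\mathrm{vol}^{\lozenge}(G^* )}{|VG|}$. Upper quantity: $v_{\mathrm{oct}}=\mathrm{vol}(B_4)\approx 3.66386$ is the volume of the hyperbolic regular ideal octahedron, and $\overline{\nu}(\mathcal{G})=\frac{|EG|\,v_{\mathrm{oct}}}{|VG|}$. *)

(* Defs.v *)
From mathcomp Require Import all_boot all_order all_algebra fingroup perm.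
From mathcomp Require Import all_classical all_reals all_analysis.

Set Implicit Arguments.
Unset Strict Implicit.
Unset Printing Implicit Defensive.

Import Order.TTheory GRing.Theory Num.Theory.
Import numFieldNormedType.Exports.

Local Open Scope classical_set_scope.
Local Open Scope ring_scope.

(* Multigraphs, with loops and parallel edges, given by oriented edges (arcs):
   an edge is a pair {a, opp a}, and a runs from org a to org (opp a). *)
Record graph (V A : Type) := Graph {
  org : A -> V;
  opp : A -> A;
  oppK : forall a, opp (opp a) = a;
  opp_neq : forall a, opp a <> a }.

Section Graphs.
Variables (V A : Type) (H : graph V A).

Fixpoint walk (P : A -> Prop) (x : V) (p : seq A) (y : V) : Prop :=
  if p is a :: p' then [/\ P a, org H a = x & walk P (org H (opp H a)) p' y]
  else x = y.

Definition joined (P : A -> Prop) (x y : V) : Prop := exists p, walk P x p y.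

Definition connected_graph : Prop :=
  inhabited V /\ forall x y : V, joined (fun=> True) x y.

(* Connected, with no cut vertex and no bridge.  Forbidding bridges only matters
   on two vertices, where it excludes a single edge.  A one-vertex graph is
   allowed, as for the quotient of the square lattice by all its translations. *)
Definition two_connected : Prop :=
  [/\ connected_graph,
      forall v x y : V, x <> v -> y <> v ->
        joined (fun a => org H a <> v /\ org H (opp H a) <> v) x y
    & forall (a : A) (x y : V), joined (fun b => b <> a /\ b <> opp H a) x y].

End Graphs.

Section SpanningTrees.
Variables (V A : finType) (H : graph V A).

(* The last clause rules out the backtracking pair [:: a; opp a], which is not a
   cycle; a loop is a cycle of length 1, two parallel edges one of length 2. *)
Definition graph_cycle (c : seq A) : Prop :=
  [/\ c != [::],
      path.cycle (fun a b => org H (opp H a) == org H b) c,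
      uniq (map (org H) c)
    & forall a, a \in c -> opp H a \notin c].

(* A set of edges is a set of arcs closed under reversal. *)
Definition spanning_tree (T : {set A}) : Prop :=
  [/\ forall a, a \in T -> opp H a \in T,
      forall x y : V, joined H (fun a => a \in T) x y
    & forall c, {subset c <= T} -> ~ graph_cycle c].

Definition tau : nat := #|[set T : {set A} | `[< spanning_tree T >]]%SET|.

End SpanningTrees.

(* Graphs on a closed oriented surface, all of whose faces are disks, encoded by
   rotation systems.  A dart is an oriented edge, edge reverses it, and node d
   is the dart following d counterclockwise around the origin of d.  Vertices
   and edges are the orbits of node and edge; for face see below. *)
Record cmap := CMap {
  dart : finType;
  edge : {perm dart};
  node : {perm dart};
  edgeK : forall d, edge (edge d) = d;
  edge_neq : forall d, edge d <> d }.

Lemma mem_porbits (T : finType) (p : {perm T}) (x : T) :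
  porbit p x \in porbits p.
Proof. by apply: imset_f; rewrite inE. Qed.

Section CMaps.
Variable M : cmap.

(* face d = node^-1 (edge d) is the dart following d along the boundary of the
   face on the left of d, so an orbit of face lists the sides of a face, and its
   cardinal is the degree of that face. *)
Definition face : {perm dart M} := (edge M * (node M)^-1)%g.

Definition vertex : finType := {v : {set dart M} | v \in porbits (node M)}.

Definition tail (d : dart M) : vertex :=
  exist _ (porbit (node M) d) (mem_porbits (node M) d).

Definition skeleton : graph vertex (dart M) :=
  Graph tail (@edgeK M) (@edge_neq M).

(* The dart d of the dual is the dual edge crossing d from left to right, so its
   origin is the face on the left of d. *)
Definition dual : cmap := @CMap (dart M) (edge M) face (@edgeK M) (@edge_neq M).

End CMaps.

(* A graph in the plane invariant under a lattice identified with Z^2, given by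
   its quotient together with a choice of one vertex above each vertex of the
   quotient.  The vertices are the pairs (v, x), the translate by x of the chosen
   vertex above v, and the lift of d from the cell x ends in x + shift d. *)
Record lattice_graph := LatticeGraph {
  quotient_map :> cmap;
  shift : dart quotient_map -> int * int;
  shiftN : forall d, shift (edge quotient_map d) = - shift d }.

Section LatticeGraphs.
Variable G : lattice_graph.

Definition lift_opp (a : dart G * (int * int)) : dart G * (int * int) :=
  (edge G a.1, a.2 + shift a.1).

Lemma lift_oppK a : lift_opp (lift_opp a) = a.
Proof. by case: a => d x; rewrite /lift_opp /= edgeK shiftN addrK. Qed.

Lemma lift_opp_neq a : lift_opp a <> a.
Proof. by case: a => d x [/edge_neq]. Qed.

Definition lift : graph (vertex G * (int * int)) (dart G * (int * int)) :=
  Graph (fun a => (tail a.1, a.2)) lift_oppK lift_opp_neq.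

(* Cells of the n x n box [-n/2, n - n/2)^2; these boxes are nested and exhaust
   Z^2. *)
Definition cell (n : nat) (x : 'I_n * 'I_n) : int * int :=
  ((x.1 : nat)%:Z - (n./2)%:Z, (x.2 : nat)%:Z - (n./2)%:Z).

(* The subgraph of lift induced on the box: ((d, x), y) is the lift of d that
   starts in the cell x, provided that it ends in a cell y of the box. *)
Definition box_arc (n : nat) : finType :=
  {a : dart G * ('I_n * 'I_n) * ('I_n * 'I_n)
     | cell a.2 == cell a.1.2 + shift a.1.1}.

Definition box_org n (a : box_arc n) : vertex G * ('I_n * 'I_n) :=
  (tail (val a).1.1, (val a).1.2).

Lemma box_opp_subproof n (a : box_arc n) :
  cell (val a).1.2 == cell (val a).2 + shift (edge G (val a).1.1).
Proof. by case: a => -[[d x] y] /= /eqP->; rewrite shiftN addrK. Qed.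

Definition box_opp n (a : box_arc n) : box_arc n :=
  exist _ (edge G (val a).1.1, (val a).2, (val a).1.2) (box_opp_subproof a).

Lemma box_oppK n (a : box_arc n) : box_opp (box_opp a) = a.
Proof. by apply: val_inj; case: a => -[[d x] y] /= _; rewrite edgeK. Qed.

Lemma box_opp_neq n (a : box_arc n) : box_opp a <> a.
Proof. by case: a => -[[d x] y] Ha [/edge_neq]. Qed.

Definition Gamma (n : nat) : graph (vertex G * ('I_n * 'I_n)) (box_arc n) :=
  Graph (@box_org n) (@box_oppK n) (@box_opp_neq n).

(* The Euler characteristic makes the quotient surface a torus; the condition on
   faces says that they lift to closed faces, so that the surface carrying the
   connected graph lift is the universal cover of the torus, i.e. the plane.
   The last clause is a condition on the fundamental domain and on the basis
   of the lattice: every lattice graph admits a choice for which it holds. *)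
Definition planar_lattice_graph : Prop :=
  [/\ connected_graph lift,
      (#|porbits (node G)| + #|porbits (face G)| = #|porbits (edge G)|)%N,
      forall d, \sum_(c in porbit (face G) d) shift c = 0
    & forall n, (0 < n)%N -> connected_graph (Gamma n)].

End LatticeGraphs.

(* Replacing every edge by s parallel edges: the copies (d, 0), ..., (d, s - 1)
   are consecutive counterclockwise around the origin of d, hence appear in the
   reverse order around its end. *)
Section Parallel.
Variables (s : nat) (M : cmap).

Definition par_edge_fun (a : dart M * 'I_s) : dart M * 'I_s :=
  (edge M a.1, rev_ord a.2).

Definition par_node_fun (a : dart M * 'I_s) : dart M * 'I_s :=
  (if a.2.+1 == s then node M a.1 else a.1, ordS a.2).

Lemma par_edge_funK : involutive par_edge_fun.
Proof. by case=> d k; rewrite /par_edge_fun /= edgeK rev_ordK. Qed.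

Lemma par_node_fun_inj : injective par_node_fun.
Proof.
move=> [d k] [d' k'] E.
have ekk : k = k' by apply: ordS_inj; exact: (congr1 snd E).
move: (congr1 fst E); rewrite /= -ekk.
by case: ifP => _ => [/perm_inj|] ->.
Qed.

Definition par_edge : {perm dart M * 'I_s} := perm (inv_inj par_edge_funK).
Definition par_node : {perm dart M * 'I_s} := perm par_node_fun_inj.

Lemma par_edgeK a : par_edge (par_edge a) = a.
Proof. by rewrite !permE par_edge_funK. Qed.

Lemma par_edge_neq a : par_edge a <> a.
Proof. by case: a => d k; rewrite permE => -[/edge_neq]. Qed.

Definition par_map : cmap :=
  @CMap (dart M * 'I_s)%type par_edge par_node par_edgeK par_edge_neq.

End Parallel.

Section ParallelLattice.
Variables (s : nat) (G : lattice_graph).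

Definition par_shift (a : dart (par_map s G)) : int * int := shift a.1.

Lemma par_shiftN a : par_shift (edge (par_map s G) a) = - par_shift a.
Proof. by rewrite /par_shift /= permE /= shiftN. Qed.

Definition parallel : lattice_graph :=
  @LatticeGraph (par_map s G) par_shift par_shiftN.

End ParallelLattice.

Section Quantities.
Variable R : realType.

Definition entropy (G : lattice_graph) : R :=
  limn (fun n : nat => ln (tau (Gamma G n))%:R
                       / #|{: vertex G * ('I_n * 'I_n)}|%:R : R).

(* The integrand takes the junk value ln 0 = 0 only at isolated points. *)
Definition lobachevsky (theta : R) : R :=
  - \int[lebesgue_measure]_(t in `[0, theta]) ln `|2 * sin t|.

Definition vol_bipyramid (n : nat) : R :=
  2 * n%:R * lobachevsky (pi / n%:R).

Definition v_oct : R := vol_bipyramid 4.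

Definition vol_lozenge (M : cmap) : R :=
  \sum_(f in porbits (face M)) vol_bipyramid #|f|.

Definition nu_lozenge (G : lattice_graph) : R :=
  (vol_lozenge G + vol_lozenge (dual G)) / #|porbits (node G)|%:R.

Definition nu_bar (G : lattice_graph) : R :=
  #|porbits (edge G)|%:R * v_oct / #|porbits (node G)|%:R.

End Quantities.

(* Main.v *)
(* Spanning trees of the s-fold parallel graph lie over spanning trees of the
   original graph, and a tree with N - 1 edges has s^(N-1) lifts, so the entropy
   grows by exactly ln s.  The hypothesis nu_lozenge <= 2 pi z with nu_lozenge > 0
   forces the entropy sequence to converge, since a divergent limit is 0 by
   convention.

   Lower bound: faces of G keep their degree, the new faces are bigons of volume
   0, and a vertex of degree n becomes one of degree s n.  With L the Lobachevsky
   function, vol(B_(sn)) - vol(B_n) = 2n (s L(x/s) - L(x)) at x = pi/n, and this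
   is < 2 pi ln s because the derivative of s L(x/s) - L(x) - x ln s is
   ln (sin x / (s sin(x/s))) < 0.

   Upper bound: a tree of the parallel graph uses at most one copy of each edge,
   so its entropy is at most (|E|/|V|) ln (1 + s).  It remains to see
   2 pi ln (1 + s) < s v_oct; as (1 + s)^2 <= 3^s, this follows from
   v_oct > pi ln 3. *)

Require Import Defs.
From mathcomp Require Import all_boot all_order all_algebra fingroup perm.
From mathcomp Require Import all_classical all_reals all_analysis.
From mathcomp Require Import measurable_realfun ring lra zify.
Import Order.TTheory GRing.Theory Num.Theory.
Import numFieldNormedType.Exports.
Import Defs.

Set Implicit Arguments.
Unset Strict Implicit.
Unset Printing Implicit Defensive.

(** * Spanning trees of multigraphs *)

Section Joined.
Context (V A : Type) (H : graph V A).
Implicit Types (P Q : A -> Prop) (x y z : V) (p q : seq A).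

Lemma joined_refl P x : joined H P x x.
Proof. by exists [::]. Qed.

Lemma joined_arc P (a : A) : P a -> joined H P (org H a) (org H (opp H a)).
Proof. by exists [:: a]. Qed.

Lemma walk_cat P x p y q z :
  walk H P x p y -> walk H P y q z -> walk H P x (p ++ q) z.
Proof.
elim: p x => [|a p IHp] x /=; first by move->.
by case=> Pa ax /IHp{}IHp /IHp.
Qed.

Lemma joined_trans P y x z : joined H P x y -> joined H P y z -> joined H P x z.
Proof. by move=> [p wp] [q wq]; exists (p ++ q); exact: walk_cat wp wq. Qed.

Lemma joined_bind P Q x y :
  (forall a, P a -> joined H Q (org H a) (org H (opp H a))) ->
  joined H P x y -> joined H Q x y.
Proof.
move=> PQ [p]; elim: p x => [|a p IHp] x /=; first by move->; exact: joined_refl.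
by case=> Pa <- /IHp; apply: joined_trans; exact: PQ.
Qed.

Lemma joined_sub P Q x y :
  (forall a, P a -> Q a) -> joined H P x y -> joined H Q x y.
Proof. by move=> PQ; apply: joined_bind => a /PQ; exact: joined_arc. Qed.

Lemma joined_sym P x y :
  (forall a, P a -> P (opp H a)) -> joined H P x y -> joined H P y x.
Proof.
move=> Popp [p]; elim: p x => [|a p IHp] x /=; first by move->; exact: joined_refl.
case=> Pa <- /IHp /joined_trans; apply.
by have := joined_arc (Popp a Pa); rewrite oppK.
Qed.

Lemma joined_exit P (W : V -> Prop) x y : joined H P x y -> W x -> ~ W y ->
  exists a, [/\ P a, W (org H a) & ~ W (org H (opp H a))].
Proof.
move=> [p]; elim: p x => [|a p IHp] x /=; first by move->.
case=> Pa <- wp Wa nWy; have [Wa'|nWa'] := EM (W (org H (opp H a))); last by exists a.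
exact: IHp wp Wa' nWy.
Qed.

End Joined.

Section SimpleWalks.
Context (V A : eqType) (H : graph V A).
Implicit Types (P : A -> Prop) (x y : V) (p : seq A).

Definition simple_walk P x p y :=
  [/\ walk H P x p y, uniq (map (org H) p) & y \notin map (org H) p].

Lemma walkP P x p y a : walk H P x p y -> a \in p -> P a.
Proof.
elim: p x => [|b p IHp] x //= [Pb _ wp]; rewrite in_cons => /orP[/eqP->//|].
exact: IHp wp.
Qed.

Lemma walk_drop P x p y z : walk H P x p y -> z \in map (org H) p ->
  exists2 q, walk H P z q y & suffix q p.
Proof.
elim: p x => [|a p IHp] x //= [Pa ax wp]; rewrite in_cons => /orP[/eqP->|zp].
  by exists (a :: p) => //; exact: suffix_refl.
by have [q wq qp] := IHp _ wp zp; exists q => //; exact: suffix_trans qp (suffix_suffix [:: a] p).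
Qed.

(** Loop erasure from the far end: when the new origin already occurs in the simple walk found for
    the rest, the suffix starting there is used instead, and suffixes of simple walks are simple. *)
Lemma joined_simple P x y : joined H P x y -> exists p, simple_walk P x p y.
Proof.
move=> [p]; elim: p x => [|a p IHp] x /=; first by move->; exists [::].
case=> Pa <- /IHp[q [wq uq yq]].
have [->|ya] := eqVneq y (org H a); first by exists [::].
have [aq|aq] := boolP (org H a \in map (org H) q).
  have [q' wq' /suffixP[q'' def_q]] := walk_drop wq aq.
  exists q'; split=> //.
    by move: uq; rewrite def_q map_cat cat_uniq => /and3P[].
  by move: yq; rewrite def_q map_cat mem_cat negb_or => /andP[].
by exists (a :: q); split=> //=; [rewrite aq|rewrite in_cons negb_or ya].
Qed.

(** After [b], its reverse could only be the very next arc, since its origin is the vertex just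
    reached. The walk would then return to the origin of [b], which must neither recur as an origin
    nor be the end [y]. *)
Lemma simple_walk_opp P x p y a : simple_walk P x p y -> a \in p -> opp H a \notin p.
Proof.
suff head b q z : simple_walk P z (b :: q) y -> opp H b \notin q.
  elim: p x => [|b p IHp] x //= sp.
  have swp : simple_walk P (org H (opp H b)) p y.
    case: sp => /= -[_ _ wp] /andP[_ up]; rewrite in_cons negb_or => /andP[_ yp].
    by split.
  rewrite !in_cons => /orP[/eqP->|ap].
    by rewrite negb_or (head _ _ _ sp) andbT; apply/eqP; exact: opp_neq.
  rewrite negb_or (IHp _ swp ap) andbT; apply/eqP => ab.
  by have := head _ _ _ sp; rewrite -ab oppK ap.
case: q => // c q [] /= [_ _ [_ cb wq]] /and3P[nb nc uq].
rewrite !in_cons !negb_or => /and3P[yb yc yq].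
apply/andP; split; last first.
  by apply: contra nc => bq; rewrite cb; exact: map_f.
apply/eqP => bc; move: wq; rewrite -bc oppK.
case: q nb {nc uq yq} => [_ /eqP|d q nb [_ db _]] /=.
  by rewrite eq_sym (negbTE yb).
by move: nb; rewrite !in_cons db eqxx /= orbT.
Qed.

End SimpleWalks.

Section Trees.
Import boot.fintype boot.finset.
Context (V A : finType) (H : graph V A).
Implicit Types (T : {set A}) (W : {set V}).

(** The arc [a] closes a simple walk leading back to its origin. That neither [a] nor its reverse
    satisfies [P] gives the clause of [graph_cycle] against backtracking pairs. *)
Lemma simple_walk_cycle P a p :
  simple_walk H P (org H (opp H a)) p (org H a) -> ~ P a -> ~ P (opp H a) ->
  graph_cycle H (a :: p).
Proof.
move=> sp nPa nPa'; have [wp up ap] := sp.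
split=> //=; last 2 first.
- by rewrite ap.
- move=> b; rewrite !in_cons => /orP[/eqP->|bp].
    rewrite negb_or; apply/andP; split; first by apply/eqP; exact: opp_neq.
    by apply/negP => /(walkP wp).
  rewrite negb_or (simple_walk_opp sp bp) andbT; apply/eqP => ba.
  by apply: nPa'; rewrite -ba oppK; exact: walkP wp bp.
suff closing b : walk H P (org H (opp H b)) p (org H a) ->
    path (fun a b => org H (opp H a) == org H b) b (rcons p a) by exact: closing.
elim: p b {sp wp up ap} => [|c p IHp] b /=; first by move=> ->; rewrite eqxx.
by case=> _ <- /IHp ->; rewrite eqxx.
Qed.

(* A connected subgraph is grown one leaf at a time; at k = |V| - 1 an arc of an
   acyclic T outside T0 would close a cycle. *)
Lemma subtree_of_size T (r : V) (k : nat) :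
  (forall a, a \in T -> opp H a \in T) ->
  (forall x y, joined H (fun a => a \in T) x y) -> (k < #|V|)%N ->
  exists W T0, [/\ #|W| = k.+1, T0 \subset T,
    forall a, a \in T0 -> (opp H a \in T0) && (org H a \in W),
    #|T0| = k.*2 &
    forall v, v \in W -> joined H (fun a => a \in T0) r v].
Proof.
move=> oppT connT; elim: k => [_|k IHk kV].
  exists [set r]%SET, set0; split; rewrite ?cards1 ?sub0set ?cards0//.
    by move=> a; rewrite in_set0.
  by move=> v; rewrite inE => /eqP->; exact: joined_refl.
have [W [T0 [cW sT0 oT0 cT0 jW]]] := IHk (ltnW kV).
have [v nWv] : exists v, v \notin W.
  apply/existsP; rewrite -negb_forall; apply/negP => /forallP WV.
  have /eqP E : W == [set: V]%SET by rewrite eqEsubset subsetT; apply/subsetP.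
  by move: kV; rewrite -cW E cardsT ltnn.
have [w Ww] : exists w, w \in W by apply/set0Pn; rewrite -card_gt0 cW.
have [a [Ta Wa nWa]] := joined_exit (W := fun u => u \in W) (connT w v) Ww (negP nWv).
have nT0a : a \notin T0 by apply/negP => /oT0 /andP[/oT0 /andP[_ /nWa]].
have nT0a' : opp H a \notin T0 by apply/negP => /oT0 /andP[_ /nWa].
exists (org H (opp H a) |: W)%SET, (a |: (opp H a |: T0))%SET; split.
- by rewrite cardsU1 (introN idP nWa) cW.
- by rewrite !subUset !sub1set Ta oppT.
- move=> b; rewrite !inE => /or3P[/eqP->|/eqP->|/oT0/andP[-> ->]]; rewrite ?oppK ?eqxx ?orbT//.
  by rewrite Wa !orbT.
- rewrite !cardsU1 !inE negb_or nT0a nT0a' andbT cT0 doubleS.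
  by have /eqP := @opp_neq _ _ H a; rewrite eq_sym => ->.
- have sub b : b \in T0 -> b \in (a |: (opp H a |: T0))%SET by rewrite !inE => ->; rewrite !orbT.
  move=> u; rewrite !inE => /orP[/eqP->|Wu]; last exact: joined_sub sub (jW _ Wu).
  apply: joined_trans (joined_sub sub (jW _ Wa)) _.
  by apply: joined_arc; rewrite !inE eqxx.
Qed.

(** The factor 2 comes from counting arcs, two for each of the |V| - 1 edges. The subtree [T0] with
    |V| - 1 edges already spans, so any further arc of [T] would close a cycle. *)
Lemma card_spanning_tree T (r : V) : spanning_tree H T -> #|T| = (#|V|.-1).*2.
Proof.
move=> [oppT connT acyT].
have V0 : (0 < #|V|)%N by apply/card_gt0P; exists r.
have [] := @subtree_of_size T r #|V|.-1 oppT connT; first by rewrite prednK.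
move=> W [T0 [cW sT0 oT0 cT0 jW]].
rewrite prednK// in cW.
have WT v : v \in W.
  have /eqP -> : W == [set: V]%SET by rewrite eqEcard subsetT cardsT cW /=.
  by rewrite inE.
suff -> : T = T0 by [].
apply/eqP; rewrite eqEsubset sT0 andbT; apply/subsetP => a Ta.
apply/negP => /negP nTa.
have oT0' b : b \in T0 -> opp H b \in T0 by move=> /oT0 /andP[].
have j : joined H (fun a => a \in T0) (org H (opp H a)) (org H a).
  by apply: joined_trans (jW _ (WT _)); apply: joined_sym oT0' (jW _ (WT _)).
have [p sp] := joined_simple j.
apply: (acyT (a :: p)).
  move=> b; rewrite in_cons => /orP[/eqP->//|].
  by case: sp => wp _ _ /(walkP wp); exact: (subsetP sT0).
apply: simple_walk_cycle sp _ _; first exact/negP.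
by move=> /oT0'; rewrite oppK; exact/negP.
Qed.

End Trees.

(** * Edges counted by a choice of one arc each, and the crude bound on the number of trees *)

Section Orientation.
Import boot.fintype boot.finset.
Context (V A : finType) (H : graph V A).

(* One of the two arcs of every edge. *)
Definition orientation : {set A} := [set a | enum_rank a < enum_rank (opp H a)]%SET.

Lemma orientation_opp a : (opp H a \in orientation) = (a \notin orientation).
Proof.
rewrite !inE oppK -leqNgt ltn_neqAle.
case: eqP => // E; have /enum_rank_inj aE : enum_rank (opp H a) = enum_rank a by exact: val_inj.
by case: (@opp_neq _ _ H a).
Qed.

Lemma card_orientation (T : {set A}) : (forall a, a \in T -> opp H a \in T) ->
  #|T| = (#|T :&: orientation|.*2)%N.
Proof.
move=> oppT.
have oppTE a : (opp H a \in T) = (a \in T).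
  by apply/idP/idP => [/oppT|/oppT//]; rewrite oppK.
rewrite -addnn -(cardsID orientation T); congr (_ + _)%N.
rewrite -(card_imset _ (inv_inj (@oppK _ _ H))); apply: eq_card => a.
apply/imsetP/setIP => [[b + ->]|[Ta pa]].
  by rewrite inE oppTE orientation_opp => /andP[-> ->].
by exists (opp H a); rewrite ?oppK// inE oppTE Ta orientation_opp pa.
Qed.

(** A spanning tree is determined by its arcs in [orientation], and these form a subset of size |V|
    - 1 among |A| / 2 arcs. *)
Lemma tau_le_bin (r : V) : (tau H <= 'C(#|A|./2, #|V|.-1))%N.
Proof.
have -> : #|A|./2 = #|orientation|.
  by rewrite -cardsT (@card_orientation [set: A]%SET) ?setTI ?doubleK// => a; rewrite !inE.
suff inj : {in [set T | `[< spanning_tree H T >]]%SET &, injective (fun T => T :&: orientation)}.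
  rewrite -cards_draws /tau -(card_in_imset inj).
  apply: subset_leq_card; apply/subsetP => B /imsetP[T + ->].
  rewrite inE => /asboolP treeT; rewrite inE subsetIr /=.
  have [oppT _ _] := treeT.
  by rewrite -(inj_eq double_inj) -(card_orientation oppT) (card_spanning_tree r treeT).
suff sub T S : spanning_tree H T -> spanning_tree H S ->
    T :&: orientation = S :&: orientation -> T \subset S.
  move=> T S; rewrite !inE => /asboolP tT /asboolP tS E.
  by apply/eqP; rewrite eqEsubset (sub T S) ?(sub S T).
move=> [oppT _ _] [oppS _ _] E; apply/subsetP => a Ta.
have [pa|pa] := boolP (a \in orientation).
  by have : a \in S :&: orientation; [rewrite -E inE Ta|rewrite inE => /andP[]].
rewrite -(oppK H a) oppS//; have : opp H a \in S :&: orientation.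
  by rewrite -E inE oppT// orientation_opp.
by rewrite inE => /andP[].
Qed.

End Orientation.

(** * Spanning trees of an s-fold parallel graph *)

Section ParallelTrees.
Import boot.fintype boot.finset.
Context (s : nat) (V A V' A' : finType) (H : graph V A) (H' : graph V' A').
Context (f : V' -> V) (p : A' -> A) (q : A' -> 'I_s).

(** [p] sends a copy to the arc that it copies and [q] is its index, so that (p, q) is a bijection
    onto [A * 'I_s]. The indices of an arc and of its reverse are not related, which accommodates
    the reversal of indices along an edge. *)
Record parallel_cover : Prop := ParallelCover {
  cover_vertex : bijective f;
  cover_org : forall a, f (org H' a) = org H (p a);
  cover_opp : forall a, p (opp H' a) = opp H (p a);
  cover_inj : forall a b, p a = p b -> q a = q b -> a = b;
  cover_surj : forall a k, exists2 b, p b = a & q b = k }.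

Context (cov : parallel_cover).

Lemma cover_orgI a b : (org H' a == org H' b) = (org H (p a) == org H (p b)).
Proof. by rewrite -!(cover_org cov) (bij_eq (cover_vertex cov)). Qed.

Lemma cover_path a c :
  path (fun a b => org H (opp H a) == org H b) (p a) (map p c)
  = path (fun a b => org H' (opp H' a) == org H' b) a c.
Proof.
by rewrite path_map; apply: eq_path => b d /=; rewrite cover_orgI (cover_opp cov).
Qed.

Lemma cover_cycleE c :
  path.cycle (fun a b => org H (opp H a) == org H b) (map p c)
  = path.cycle (fun a b => org H' (opp H' a) == org H' b) c.
Proof. by case: c => //= a c; rewrite -map_rcons cover_path. Qed.

Lemma cover_uniqE c : uniq (map (org H) (map p c)) = uniq (map (org H') c).
Proof.
rewrite -(map_inj_uniq (bij_inj (cover_vertex cov)) (map (org H') c)) -!map_comp.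
by congr uniq; apply: eq_map => a /=; rewrite (cover_org cov).
Qed.

Lemma graph_cycle_lift c : graph_cycle H (map p c) -> graph_cycle H' c.
Proof.
move=> [c0]; rewrite cover_cycleE cover_uniqE => cc uc oc; split=> //.
  by case: c c0 {cc uc oc}.
move=> a ac; apply/negP => ac'; have := oc (p a) (map_f p ac).
by rewrite -(cover_opp cov) map_f.
Qed.

(** Injectivity on [T] prevents two parallel arcs, traversed in opposite directions, from projecting
    to a backtracking pair. *)
Lemma graph_cycle_proj (T : {set A'}) c :
  (forall a, a \in T -> opp H' a \in T) -> {in T &, injective p} ->
  {subset c <= T} -> graph_cycle H' c -> graph_cycle H (map p c).
Proof.
move=> oppT pinj cT [c0 cc uc oc]; split; rewrite ?cover_cycleE ?cover_uniqE//.
  by case: c c0 {cc uc oc cT}.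
move=> _ /mapP[a ac ->]; apply/mapP => -[b bc]; rewrite -(cover_opp cov).
by move=> /(pinj _ _ (oppT _ (cT _ ac)) (cT _ bc)) ab; have := oc a ac; rewrite ab bc.
Qed.

Lemma joined_proj (T : {set A'}) x y : joined H' (fun a => a \in T) x y ->
  joined H (fun a => a \in p @: T) (f x) (f y).
Proof.
move=> [c]; elim: c x => [|a c IHc] x /=; first by move->; exact: joined_refl.
case=> Ta <- /IHc; apply: joined_trans.
rewrite !(cover_org cov) (cover_opp cov).
by apply: joined_arc; exact: imset_f.
Qed.

Lemma joined_lift (T : {set A'}) x y :
  joined H (fun a => a \in p @: T) (f x) (f y) -> joined H' (fun a => a \in T) x y.
Proof.
have finj := bij_inj (cover_vertex cov).
move=> [c]; elim: c x => [|b c IHc] x /=; first by move/finj->; exact: joined_refl.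
case=> /imsetP[a Ta ->]; rewrite -(cover_org cov) => /finj <-.
rewrite -(cover_opp cov) -(cover_org cov) => /IHc; apply: joined_trans.
exact: joined_arc.
Qed.

(** Two copies of one edge form a cycle, so an acyclic [T] contains at most one copy of each.
    Conversely, once [p] is injective on [T], a cycle in [T] projects to a cycle downstairs, while
    cycles of the projection always lift. *)
Lemma spanning_tree_cover (T : {set A'}) :
  spanning_tree H' T <->
  [/\ forall a, a \in T -> opp H' a \in T, {in T &, injective p}
    & spanning_tree H (p @: T)].
Proof.
have [g fK gK] := cover_vertex cov.
split=> [[oppT connT acyT]|[oppT pinj [_ connT acyT]]]; last first.
  split=> // [x y|c cT cyc]; first exact/joined_lift/connT.
  apply: (acyT _ _ (graph_cycle_proj oppT pinj cT cyc)).
  by move=> _ /mapP[a /cT Ta ->]; exact: imset_f.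
split=> //.
  move=> a b Ta Tb pab; apply/eqP; apply: contraT => /eqP nab; exfalso.
  have oab : org H' a = org H' b by apply/eqP; rewrite cover_orgI pab.
  have oab' : org H' (opp H' a) = org H' (opp H' b).
    by apply/eqP; rewrite cover_orgI !(cover_opp cov) pab.
  (* Over a loop, [a] alone is already a cycle; otherwise [a] followed by the reverse of [b] is one
     of length 2. *)
  have [loop|nloop] := eqVneq (org H' (opp H' a)) (org H' a).
    apply: (acyT [:: a]) => [c|]; first by rewrite inE => /eqP->.
    split=> //=; first by rewrite loop eqxx.
    by move=> c; rewrite !inE => /eqP->; apply/eqP; exact: opp_neq.
  apply: (acyT [:: a; opp H' b]) => [c|].
    by rewrite !inE => /orP[]/eqP->//; exact: oppT.
  split=> //=.
  - by rewrite oppK oab' oab !eqxx.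
  - by rewrite inE -oab' eq_sym nloop.
  - move=> c; rewrite !inE => /orP[]/eqP->; rewrite negb_or ?oppK.
      apply/andP; split; apply/eqP; first exact: opp_neq.
      by move/(inv_inj (@oppK _ _ H')).
    apply/andP; split; apply/eqP; first by move=> ba; apply: nab.
    by move=> /esym; exact: opp_neq.
split.
- by move=> _ /imsetP[a Ta ->]; rewrite -(cover_opp cov); apply: imset_f; exact: oppT.
- by move=> x y; rewrite -(gK x) -(gK y); exact/joined_proj/connT.
- move=> d dT cyc.
  have [c cT def_d] : exists2 c, {subset c <= T} & d = map p c.
    elim: d dT {cyc} => [|b d IHd] dT; first by exists [::].
    have [c cT ->] := IHd (fun x xd => dT x (mem_behead (s := b :: d) xd)).
    have /imsetP[a Ta ->] := dT b (mem_head _ _).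
    exists (a :: c) => // x; rewrite inE => /orP[/eqP->//|]; exact: cT.
  by apply: (acyT c cT); apply: graph_cycle_lift; rewrite -def_d.
Qed.

End ParallelTrees.

Section CountCovers.
Import boot.fintype boot.finset boot.finfun.
Context (s : nat) (V A V' A' : finType) (H : graph V A) (H' : graph V' A').
Context (f : V' -> V) (p : A' -> A) (q : A' -> 'I_s).
Context (cov : parallel_cover H H' f p q).
Local Notation orientation := (orientation H).

Definition sections (T : {set A}) : {set {set A'}} :=
  [set S : {set A'} | `[< [/\ forall a, a \in S -> opp H' a \in S,
     {in S &, injective p} & p @: S = T] >]]%SET.

(* The copy chosen for an edge is indexed by its arc in the orientation; the
   opposite arc gets the opposite of that copy. *)
Definition section_of (T : {set A}) (g : {ffun A -> 'I_s}) : {set A'} :=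
  [set a | (p a \in T) && if p a \in orientation then q a == g (p a)
           else q (opp H' a) == g (p (opp H' a))]%SET.

Lemma in_section_of T g a : (a \in section_of T g) =
  (p a \in T) && if p a \in orientation then q a == g (p a)
                 else q (opp H' a) == g (p (opp H' a)).
Proof. by rewrite [LHS]in_set. Qed.

(** A section amounts to an independent choice of one of s copies for each edge of [T]. The choices
    are encoded as functions on all arcs that take the default value [k0] off [T :&: orientation],
    and [section_of] is a bijection from these to the sections. *)
Lemma card_sections (k0 : 'I_s) (T : {set A}) :
  (forall a, a \in T -> opp H a \in T) ->
  #|sections T| = (s ^ #|T :&: orientation|)%N.
Proof.
move=> oppT.
have oppTE a : (opp H a \in T) = (a \in T).
  by apply/idP/idP => [/oppT|/oppT//]; rewrite oppK.
have qI := cover_inj cov.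
rewrite -[in RHS](card_ord s) -(card_pffun_on k0 (mem (T :&: orientation)) (mem 'I_s)).
have inj : {in pffun_on k0 (mem (T :&: orientation)) (mem 'I_s) &, injective (section_of T)}.
  move=> g h /pffun_onP[/supportP g0 _] /pffun_onP[/supportP h0 _] gh.
  apply/ffunP => a; have [|na] := boolP (a \in T :&: orientation); last first.
    by rewrite g0 ?h0.
  rewrite inE => /andP[Ta pa].
  have [b pb qb] := cover_surj cov a (g a).
  have : b \in section_of T h by rewrite -gh in_section_of pb Ta pa qb eqxx.
  by rewrite in_section_of pb Ta pa qb => /eqP.
rewrite -(card_in_imset inj); apply: eq_card => S; rewrite inE.
apply/asboolP/imsetP => [[oppS pinj pS]|[g _ ->]]; last first.
  split=> [a|a b|].
  - rewrite !in_section_of oppK !(cover_opp cov) oppTE orientation_opp => /andP[->].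
    by case: ifP => _; rewrite ?(cover_opp cov) ?oppK.
  - rewrite !in_section_of => /andP[_ qa] /andP[_ qb] pab; move: qa qb; rewrite -pab.
    case: ifP => _ /eqP qa /eqP qb; first by apply: qI => //; rewrite qa qb.
    apply: (inv_inj (@oppK _ _ H')); apply: qI; rewrite ?(cover_opp cov) ?pab//.
    by rewrite qa qb !(cover_opp cov) pab.
  - apply/setP => a; apply/imsetP/idP => [[b]|Ta]; first by rewrite in_section_of => /andP[? _] ->.
    have [pa|pa] := boolP (a \in orientation).
      by have [b pb qb] := cover_surj cov a (g a); exists b; rewrite // in_section_of pb Ta pa qb eqxx.
    have [b pb qb] := cover_surj cov (opp H a) (g (opp H a)).
    exists (opp H' b); last by rewrite (cover_opp cov) pb oppK.
    by rewrite in_section_of (cover_opp cov) pb oppK Ta (negbTE pa) oppK qb pb eqxx.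

(* The preimage of [S] reads off the index of the arc of [S] above [a], which is unique because [p]
   is injective on [S]. *)
pose g := [ffun a => if a \in T :&: orientation then
    oapp q k0 [pick b in S | p b == a] else k0].
have gE b : b \in S -> p b \in orientation -> g (p b) = q b.
  move=> Sb pb; rewrite ffunE inE pb -pS imset_f//=.
  case: pickP => [c /andP[Sc /eqP pc]|/(_ b)]; first by rewrite /= (pinj _ _ Sc Sb pc).
  by rewrite /= Sb eqxx.
exists g; first by apply/pffun_onP; split=> //; apply/supportP => a na; rewrite ffunE (negbTE na).
have pos_opp a : p a \notin orientation -> p (opp H' a) \in orientation.
  by rewrite (cover_opp cov) orientation_opp.
apply/setP => a; rewrite in_section_of; apply/idP/andP => [Sa|[]].
  split; first by rewrite -pS imset_f.
  case: ifPn => pa; first by rewrite gE.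
  by rewrite gE ?oppS ?pos_opp.
rewrite -pS => /imsetP[b Sb pab]; case: ifPn => pa /eqP.
  by rewrite pab gE -?pab// => /(qI _ _ pab) ->.
have pab' : p (opp H' a) = p (opp H' b) by rewrite !(cover_opp cov) pab.
rewrite pab' gE ?oppS//; last by rewrite -pab' pos_opp.
by move=> /(qI _ _ pab') /(inv_inj (@oppK _ _ H')) ->.
Qed.

(** Spanning trees upstairs are grouped by their projection; the fibre over a tree is its set of
    sections. *)
Lemma tau_cover (k0 : 'I_s) (r : V) : tau H' = (tau H * s ^ #|V|.-1)%N.
Proof.
rewrite /tau -sum1_card.
rewrite (@partition_big _ _ _ _ _ {set A} _ (fun S : {set A'} => p @: S)
  (fun T => T \in [set T : {set A} | `[< spanning_tree H T >]]%SET)) /=; last first.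
  by move=> S; rewrite !inE => /asboolP /(spanning_tree_cover cov)[_ _ tS]; apply/asboolP.
rewrite -sum_nat_const; apply: eq_bigr => T; rewrite inE => /asboolP tT.
have [oppT _ _] := tT.
have <- : #|T :&: orientation| = #|V|.-1.
  apply: double_inj; rewrite -(card_orientation oppT); apply: (card_spanning_tree r tT).
transitivity #|sections T|; last exact: (card_sections k0 oppT).
rewrite -sum1_card; apply: eq_bigl => S.
rewrite !inE; apply/andP/asboolP => [[/asboolP /(spanning_tree_cover cov)[? ? _] /eqP]|[oppS pinj pS]].
  by split.
by rewrite pS eqxx; split=> //; apply/asboolP/(spanning_tree_cover cov); rewrite pS.
Qed.

End CountCovers.

(** * Combinatorial maps *)

Section Porbits.
Import boot.fintype boot.finset.
Context (T : finType).
Implicit Types (p : {perm T}) (x : T).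

Lemma porbit_step p x : porbit p (p x) = porbit p x.
Proof. by have := porbit_perm p 1 x; rewrite expg1. Qed.

Lemma porbit_subset p x (B : {set T}) :
  x \in B -> (forall y, y \in B -> p y \in B) -> porbit p x \subset B.
Proof.
move=> Bx pB; apply/subsetP => y /porbitP[i ->].
by elim: i => [|i IHi]; rewrite ?expg0 ?perm1// expgSr permM pB.
Qed.

Lemma card_porbit_involution p x : p (p x) = x -> p x <> x -> #|porbit p x| = 2.
Proof.
move=> ppx npx; have -> : porbit p x = [set x; p x]%SET.
  apply/eqP; rewrite eqEsubset; apply/andP; split.
    apply: porbit_subset; rewrite ?set21// => y; rewrite !inE => /orP[]/eqP->.
      by rewrite eqxx orbT.
    by rewrite ppx eqxx.
  rewrite subUset !sub1set porbit_id /=.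
  by have := mem_porbit p 1 x; rewrite expg1.
by rewrite cards2; move/eqP: npx; rewrite eq_sym => ->.
Qed.

(** The contribution of an orbit is spread evenly over its elements. Sums over vertices and faces
    thereby become sums over darts, which can be compared dart by dart between a map and its
    parallel version. *)
Lemma sum_porbits (R : numFieldType) (g : nat -> R) p :
  (\sum_(f in porbits p) g #|f| = \sum_x g #|porbit p x| / #|porbit p x|%:R)%R.
Proof.
rewrite [RHS](@partition_big _ _ _ _ _ {set T} _ (porbit p) (fun f => f \in porbits p)) /=;
  last by move=> x _; exact: mem_porbits.
apply: eq_bigr => f /imsetP[x _ ->].
rewrite (eq_bigl (fun y => y \in porbit p x)) => [|y]; last by rewrite eq_porbit_mem.
rewrite (eq_bigr (fun=> g #|porbit p x| / #|porbit p x|%:R)%R) => [|y yx]; last first.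
  by move: yx; rewrite -eq_porbit_mem => /eqP->.
rewrite sumr_const -[RHS]mulr_natr divfK// pnatr_eq0; exact: card_porbit_neq0.
Qed.

End Porbits.

Section PorbitsImage.
Import boot.fintype boot.finset.

Lemma porbit_imset (T U : finType) (p : {perm T}) (q : {perm U}) (h : T -> U) (x : T) :
  (forall y, q (h y) = h (p y)) -> porbit q (h x) = h @: porbit p x.
Proof.
move=> qh; apply/eqP; rewrite eqEsubset; apply/andP; split.
  apply: porbit_subset; first by rewrite imset_f ?porbit_id.
  move=> _ /imsetP[y yx ->]; rewrite qh imset_f//.
  by rewrite -eq_porbit_mem porbit_step eq_porbit_mem.
apply/subsetP => _ /imsetP[_ /porbitP[i ->] ->].
suff -> : h ((p ^+ i)%g x) = (q ^+ i)%g (h x) by exact: mem_porbit.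
by elim: i => [|i IHi]; rewrite ?expg0 ?perm1// !expgSr !permM -qh IHi.
Qed.

Lemma card_porbit_imset (T U : finType) (p : {perm T}) (q : {perm U}) (h : T -> U) (x : T) :
  injective h -> (forall y, q (h y) = h (p y)) -> #|porbit q (h x)| = #|porbit p x|.
Proof. by move=> hI /porbit_imset ->; rewrite card_imset. Qed.

End PorbitsImage.

(** * Degrees of vertices and faces after parallel replacement *)

Section ParallelMap.
Import boot.fintype boot.finset.
Context (s : nat) (M : cmap).
Local Notation par := (par_map s M).
Implicit Types (d : dart M) (k : 'I_s).

Lemma par_nodeE d k : node par (d, k) = par_node_fun (d, k).
Proof. by rewrite permE. Qed.

Lemma par_edgeE d k : edge par (d, k) = (edge M d, rev_ord k).
Proof. by rewrite permE. Qed.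

(** Going around a vertex, the indices of the copies of a dart increase up to s - 1, then wrap to 0
    while the dart advances by [node M]. Hence every copy is in the orbit of copy 0, and the copies
    0 of successive darts share an orbit. *)
Lemma porbit_par_node d k :
  porbit (node par) (d, k) = setX (porbit (node M) d) [set: 'I_s]%SET.
Proof.
have s0 : 0 < s by case: k => m /=; case: s.
pose o := Ordinal s0.
have to0 e j : porbit (node par) (e, j) = porbit (node par) (e, o).
  case: j => m; elim: m => [|m IHm] ms; first by congr (porbit _ (_, _)); exact: val_inj.
  rewrite -(IHm (ltnW ms)) -[RHS]porbit_step par_nodeE /par_node_fun /=.
  rewrite (ltn_eqF ms); congr (porbit _ (_, _)); apply: val_inj => /=.
  by rewrite modn_small.
have to_node e : porbit (node par) (node M e, o) = porbit (node par) (e, o).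
  have pS : s.-1 < s by rewrite prednK.
  rewrite -(to0 e (Ordinal pS)) -[RHS]porbit_step par_nodeE /par_node_fun /= prednK// eqxx.
  congr (porbit _ (_, _)); apply: val_inj => /=; by rewrite prednK// modnn.
apply/eqP; rewrite eqEsubset; apply/andP; split.
  apply: porbit_subset => [|[e j]]; rewrite !inE ?porbit_id// !andbT => ed.
  rewrite par_nodeE /=; case: ifP => // _.
  by rewrite -eq_porbit_mem porbit_step eq_porbit_mem.
apply/subsetP => -[e j]; rewrite !inE andbT /= => /porbitP[i ->].
rewrite -eq_porbit_mem to0 (to0 d).
elim: i => [|i IHi]; first by rewrite expg0 perm1.
by rewrite expgSr permM to_node.
Qed.

Lemma card_porbit_par_node (a : dart par) :
  #|porbit (node par) a| = (s * #|porbit (node M) a.1|)%N.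
Proof. by case: a => d k; rewrite porbit_par_node cardsX cardsT card_ord mulnC. Qed.

Lemma faceE (N : cmap) (d : dart N) : node N (face N d) = edge N d.
Proof. by rewrite permM permKV. Qed.

(** The last copy is the leftmost one seen from its origin, so the face on its left is a face of
    [M]. *)
Lemma par_face_last d k : k.+1 = s -> face par (d, k) = (face M d, k).
Proof.
(* [face] involves the inverse of [node]; applying [node] to both sides turns the claim into one
   about [edge]. *)
move=> ks; apply: (@perm_inj _ (node par)); rewrite faceE par_edgeE par_nodeE.
rewrite /par_node_fun /= ks eqxx faceE; congr (_, _); apply: val_inj => /=.
by rewrite ks modnn subnn.
Qed.

(** Left of copy k lies copy k + 1, and the face between them returns along that copy, whose index
    from the other end is [rev_ord (ordS k)]. *)
Lemma par_face_bigon d k : k.+1 < s -> face par (d, k) = (edge M d, rev_ord (ordS k)).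
Proof.
move=> ks; apply: (@perm_inj _ (node par)); rewrite faceE par_edgeE par_nodeE.
rewrite /par_node_fun /= modn_small//.
have e : (s - k.+2).+1 = s - k.+1 by rewrite -subSn// subSS.
rewrite e ltn_eqF ?ltn_subrL//; last by rewrite (leq_trans _ ks).
congr (_, _); apply: val_inj => /=.
by rewrite (modn_small ks) e modn_small// ltn_subrL/= (leq_trans _ ks).
Qed.

Lemma card_porbit_par_face (a : dart par) :
  #|porbit (face par) a| = if a.2.+1 == s then #|porbit (face M) a.1| else 2.
Proof.
case: a => d k /=; have [ks|nks] := eqVneq k.+1 s.
  apply: (card_porbit_imset (h := fun e => (e, k))) => [e e' []//|e].
  exact: par_face_last.
have ks : k.+1 < s by rewrite ltn_neqAle nks ltn_ord.
apply: card_porbit_involution; last by rewrite par_face_bigon// => -[/edge_neq].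
rewrite !par_face_bigon//=; last by rewrite modn_small// subnSK// ltn_subrL (leq_trans _ ks).
rewrite edgeK; congr (_, _); apply: val_inj => /=.
rewrite (modn_small ks) subnSK// modn_small; last by rewrite ltn_subrL (leq_trans _ ks).
by rewrite subnSK// subKn// ltnW.
Qed.

Lemma card_porbit_edge (N : cmap) (d : dart N) : #|porbit (edge N) d| = 2.
Proof. exact: card_porbit_involution (edgeK d) (@edge_neq _ d). Qed.

(** [edge] conjugates [node] into the face permutation of the dual. *)
Lemma card_porbit_dual_face (N : cmap) (d : dart N) :
  #|porbit (face (dual N)) (edge N d)| = #|porbit (node N) d|.
Proof.
apply: (card_porbit_imset (h := edge N)) => [|e]; first exact: perm_inj.
apply: (@perm_inj _ (face N)); rewrite (@faceE (dual N)) /= edgeK.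
apply: (@perm_inj _ (node N)); rewrite faceE edgeK//.
Qed.

End ParallelMap.

Section ParallelVertex.
Import boot.fintype boot.finset.

Lemma vertexP (N : cmap) (v : vertex N) : exists d, v == tail d.
Proof.
by case: v => v vN; have /imsetP[d _ vd] := vN; exists d; apply/eqP/val_inj.
Qed.

Definition vertex_dart (N : cmap) (v : vertex N) : dart N := xchoose (vertexP v).

Lemma vertex_dartK (N : cmap) : cancel (@vertex_dart N) (@tail N).
Proof. by move=> v; apply/esym/eqP; exact: (xchooseP (vertexP v)). Qed.

Lemma eq_tail (N : cmap) (d e : dart N) : (tail d == tail e) = (d \in porbit (node N) e).
Proof. by rewrite -val_eqE /= eq_porbit_mem. Qed.

Context (s : nat) (M : cmap).

Lemma eq_par_tail (a b : dart (par_map s M)) : (tail a == tail b) = (tail a.1 == tail b.1).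
Proof.
by case: a b => [d k] [e j]; rewrite !eq_tail porbit_par_node !inE andbT.
Qed.

Definition par_vertex (v : vertex (par_map s M)) : vertex M := tail (vertex_dart v).1.

Lemma par_vertex_tail (a : dart (par_map s M)) : par_vertex (tail a) = tail a.1.
Proof. by apply/eqP; rewrite -eq_par_tail vertex_dartK. Qed.

Lemma par_vertex_bij : 0 < s -> bijective par_vertex.
Proof.
move=> s0; exists (fun v => tail (M := par_map s M) (vertex_dart v, Ordinal s0)) => v.
  by rewrite -[RHS]vertex_dartK; apply/eqP; rewrite eq_par_tail vertex_dartK.
by rewrite par_vertex_tail vertex_dartK.
Qed.

End ParallelVertex.

(** * Finite boxes of the lattice graph and of its parallel version *)

Section BoxCover.
Import boot.fintype boot.finset.
Context (s n : nat) (G : lattice_graph).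

Definition box_proj (a : box_arc (parallel s G) n) : box_arc G n :=
  exist (fun a : dart G * ('I_n * 'I_n) * ('I_n * 'I_n) =>
           cell a.2 == (cell a.1.2 + shift a.1.1)%R)
    ((val a).1.1.1, (val a).1.2, (val a).2) (valP a).

Definition box_copy (a : box_arc (parallel s G) n) : 'I_s := (val a).1.1.2.

Definition box_vertex (v : vertex (parallel s G) * ('I_n * 'I_n)) :
  vertex G * ('I_n * 'I_n) := (par_vertex v.1, v.2).

(** Shifts ignore the copy index, so an arc stays in the box exactly when its projection does. *)
Lemma box_cover : 0 < s ->
  parallel_cover (Gamma G n) (Gamma (parallel s G) n) box_vertex box_proj box_copy.
Proof.
move=> s0; have [g fK gK] := par_vertex_bij G s0.
split.
- by exists (fun v => (g v.1, v.2)) => -[v x]; rewrite /box_vertex /= ?fK ?gK.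
- by move=> a; rewrite /= /box_vertex /box_org /= par_vertex_tail.
- by move=> a; apply: val_inj; rewrite /= permE.
- move=> a b /(congr1 val); rewrite /box_copy => pab qab; apply: val_inj.
  case: a b pab qab => -[[[d k] x] y] /= _ [[[[d' k'] x'] y'] /= _].
  by case=> -> -> -> ->.
- move=> [[[d x] y] a] k.
  by exists (exist (fun a : dart (parallel s G) * ('I_n * 'I_n) * ('I_n * 'I_n) =>
           cell a.2 == (cell a.1.2 + shift a.1.1)%R) ((d, k), x, y) a) => //; apply: val_inj.
Qed.

Lemma cell_inj : injective (@cell n).
Proof. by move=> [x y] [x' y'] [/addIr [/val_inj->] /addIr [/val_inj->]]. Qed.

(** The final cell of an arc is determined by its dart and its initial cell, because [cell] is
    injective. *)
Lemma card_box_arc : (#|{: box_arc G n}| <= #|dart G| * (n * n))%N.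
Proof.
have inj : injective (fun a : box_arc G n => (val a).1).
  move=> [[dx y] a] [[dx' y'] b] /= E; apply: val_inj => /=; rewrite -E; congr (_, _).
  by apply: cell_inj; move: a b; rewrite -E /= => /eqP -> /eqP ->.
by apply: leq_trans (leq_card _ inj) _; rewrite !card_prod !card_ord.
Qed.

End BoxCover.

Section Degree.
Import boot.fintype boot.finset.
(** A dart alone at its origin would be a bridge: a walk to its other end avoiding it could not
    leave the origin. *)
Lemma two_connected_degree (M : cmap) (d : dart M) :
  two_connected (skeleton M) -> (1 < #|porbit (node M) d|)%N.
Proof.
move=> [_ _ nobridge]; rewrite ltnNge; apply/negP => /card_le1_eqP deg1.
have od e : tail e = tail d -> e = d.
  move=> /(congr1 val) /= E; have ed : e \in porbit (node M) d by rewrite -E porbit_id.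
  exact: (esym (deg1 e d ed (porbit_id _ d))).
have [[|b p] /=] := nobridge d (tail d) (tail (edge M d)).
  by move=> /esym/od; exact: edge_neq.
by move=> [[nbd _] /od].
Qed.
End Degree.

Local Open Scope ring_scope.

(** * The Lobachevsky function *)

Local Notation mu := (@lebesgue_measure _).

Lemma ln_le1 (R : realType) (t : R) : t <= 2 -> ln t <= 1.
Proof.
move=> t2; have [t0|t0] := leP t 0; first by rewrite ln0.
have := @le_ln1Dx R (t - 1); have -> : 1 + (t - 1) = t by lra.
by move=> H; have {}H := H ltac:(lra); lra.
Qed.

(** This crude linear bound compares ln (2 sin t) with ln t near 0. It follows from sin t = 2 sin
    (t/2) cos (t/2), the mean value theorem for sin (t/2), and cos (t/2)^2 >= 1/2. *)
Lemma sin_ge_half (R : realType) (t : R) : 0 <= t <= pi / 2 -> t / 2 <= sin t.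
Proof.
move=> /andP[t0 tpi].
have [->|tn0] := eqVneq t 0; first by rewrite mul0r sin0.
have tgt : 0 < t by rewrite lt_neqAle eq_sym tn0.
have ct : 0 <= cos t by apply: cos_ge0_pihalf; have := pi_gt0 R; lra.
have c2 : 1 / 2 <= cos (t / 2) ^+ 2.
  move: ct; rewrite {1}(splitr t) -mulr2n cos_mulr2n; lra.
have cp : 0 < cos (t / 2) by apply: cos_gt0_pihalf; have := pi_gt0 R; lra.
have [| |c c0t] := @MVT R sin cos 0 (t / 2) _ (fun x _ => is_derive_sin x).
- by lra.
- by apply: continuous_subspaceT; exact: continuous_sin.
rewrite sin0 !subr0 => E.
have -> : sin t = cos (t / 2) * cos c * t.
  by rewrite [in LHS](splitr t) -mulr2n sin_mulr2n E -mulr_natr; field.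
have cc : cos (t / 2) <= cos c.
  move: c0t; rewrite in_itv /= => /andP[c0 ct2].
  by apply: ltW; rewrite ltr_cos ?in_itv /=; have := pi_gt0 R; lra.
have h : cos (t / 2) ^+ 2 <= cos (t / 2) * cos c by rewrite expr2 ler_pM2l.
have : 1 / 2 * t <= cos (t / 2) * cos c * t.
  by rewrite ler_wpM2r// (le_trans c2).
by rewrite mul1r mulrC.
Qed.

Lemma sin_doubled_gt0 (R : realType) (t : R) : 0 < t <= pi / 2 -> 0 < 2 * sin t.
Proof.
by move=> /andP[t0 tpi]; have := @sin_ge_half R t; rewrite (ltW t0) tpi => /(_ isT); lra.
Qed.

(** Since ln (2 sin t) lies between ln t and 1, and ln t <= 1, the function 3 - ln t is a
    nonnegative majorant with an elementary antiderivative. *)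
Lemma norm_ln_sin_le (R : realType) (t : R) : 0 < t <= pi / 2 ->
  `|ln `|2 * sin t| | <= 3 - ln t.
Proof.
move=> tI; have s0 := sin_doubled_gt0 tI.
move/andP: (tI) => [t0 tpi].
have h := @sin_ge_half R t; rewrite (ltW t0) tpi in h; have {}h := h isT.
rewrite (gtr0_norm s0).
have l1 : ln t <= ln (2 * sin t) by rewrite ler_ln ?posrE//; lra.
have l2 : ln (2 * sin t) <= 1 by apply: ln_le1; have := sin_le1 t; lra.
have l3 : ln t <= 1 by apply: ln_le1; have := pihalf_lt2 R; lra.
by rewrite ler_norml; apply/andP; split; lra.
Qed.

(** The antiderivative is 4 t - t ln t. Its value at [e] is nonnegative and is dropped, which makes
    the bound uniform in [e]. *)
Lemma integral_sub_ln_le (R : realType) (e b : R) :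
  0 < e -> e < b -> b <= 2 ->
  (\int[mu]_(t in `[e, b]) (3 - ln t)%:E <= (4 * b - (b * ln b))%:E)%E.
Proof.
move=> e0 eb b2.
have dF x : e <= x -> is_derive x 1 (fun t : R => 4 * t - t * ln t) (3 - ln x).
  move=> ex; have x0 : 0 < x by lra.
  have dl := is_derive1_ln x0.
  apply: is_derive_eq.
  rewrite /GRing.scale /=; field; lra.
have dc x : e <= x -> {for x, continuous (fun t : R => 4 * t - t * ln t)}.
  by move=> ex; apply/differentiable_continuous/derivable1_diffP; have := dF _ ex.
rewrite (@continuous_FTC2 R (fun t => 3 - ln t) (fun t => 4 * t - t * ln t)) //.
- rewrite -EFinB lee_fin lerBlDr lerDl.
  have := @ln_le1 R e ltac:(lra) => le1.
  have : e * ln e <= e * 1 by rewrite ler_pM2l.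
  lra.
- apply: continuous_in_subspaceT => x; rewrite inE /= in_itv /= => /andP[ex xb].
  by apply: cvgB; [exact: cvg_cst|apply: continuous_ln; lra].
- split.
  + by move=> x; rewrite in_itv /= => /andP[ex xb]; have := dF x (ltW ex).
  + by apply: cvg_at_right_filter; apply: dc.
  + by apply: cvg_at_left_filter; apply: dc; exact: ltW.
- by move=> x; rewrite in_itv /= => /andP[ex xb]; rewrite derive1E; have := dF x (ltW ex) => -[].
Qed.

(** Monotone convergence along the truncations to [1/(n+1), b], whose integrals are uniformly
    bounded. *)
Lemma integrable_sub_ln (R : realType) (b : R) : 0 < b <= 2 ->
  mu.-integrable `]0, b] (EFin \o (fun t : R => 3 - ln t)).
Proof.
move=> /andP[b0 b2].
pose h (t : R) : R := 3 - ln t.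
have mf (D : set R) : measurable_fun D (EFin \o h).
  by apply/measurable_EFinP/measurable_funTS/measurable_funB => //; exact: measurable_ln.
have g0 t : t <= b -> 0 <= 3 - ln t.
  by move=> tb; have := @ln_le1 R t; lra.
apply/integrableP; split; first exact: mf.
pose g (n : nat) (t : R) : \bar R := ((EFin \o h) \_ `[n.+1%:R^-1, b]) t.
have -> : (\int[mu]_(x in `]0%R, b]) `|(EFin \o h) x|
           = \int[mu]_(x in `]0%R, b]) limn (g ^~ x))%E.
  apply: eq_integral => t; rewrite inE /= in_itv /= => /andP[t0 tb].
  rewrite ger0_norm ?g0//.
  apply/esym/cvg_lim => //.
  apply: cvg_near_cst; near=> n.
  rewrite /g patchE mem_set//= in_itv /= tb andbT.
  rewrite invf_ple ?posrE// ltW//; near: n.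
  exists (Num.truncn t^-1) => // n /=.
  by rewrite truncn_le_nat.
have mg n : measurable_fun `]0, b] (g n).
  by apply: measurable_funTS; apply/(measurable_restrictT _ _).1.
have gg0 n t : `]0, b]%classic t -> (0 <= g n t)%E.
  rewrite /= in_itv /= => /andP[t0 tb].
  by rewrite /g patchE; case: ifP => //= _; rewrite lee_fin g0.
have ndg t : `]0, b]%classic t -> nondecreasing_seq (g ^~ t).
  rewrite /= in_itv /= => /andP[t0 tb] m n mn.
  rewrite /g !patchE !mem_setE !in_itv /= tb !andbT.
  case: ifP => h1; last by case: ifP => //= _; rewrite lee_fin g0.
  rewrite (le_trans _ h1) ?lexx//= lef_pV2 ?posrE// ler_nat.
  exact: mn.
rewrite (@monotone_convergence _ _ _ mu `]0, b]%classic _ g mg gg0 ndg) //.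
apply: (@le_lt_trans _ _ (4 * b - (b * ln b))%:E); last by rewrite ltry.
apply: lime_le.
  apply: ereal_nondecreasing_is_cvgn => m n mn.
  apply: ge0_le_integral => //; [exact: gg0|exact: mg|exact: mg|move=> t tb; exact: (ndg t tb m n mn)].
near=> n.
rewrite /g -integral_mkcondr.
rewrite (_ : _ `&` _ = `[n.+1%:R^-1, b]%classic)%classic.
  apply: integral_sub_ln_le => //.
  rewrite invf_plt ?posrE//; near: n.
  exists (Num.truncn b^-1) => // n /=.
  by rewrite truncn_le_nat.
apply: setIidr => t /=; rewrite !in_itv /= => /andP[nt ->].
by rewrite andbT (lt_le_trans _ nt)// invr_gt0.
Unshelve. all: by end_near.
Qed.

Lemma integrable_ln_sin (R : realType) :
  mu.-integrable `[0, pi / 2] (EFin \o (fun t : R => ln `|2 * sin t|)).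
Proof.
have p2 := pihalf_lt2 R; have p0 := pi_gt0 R.
pose h (t : R) := ln `|2 * sin t|.
have mh (D : set R) : measurable_fun D (EFin \o h).
  apply/measurable_EFinP/measurable_funTS.
  apply: measurableT_comp; first exact: measurable_ln.
  apply: measurableT_comp => //.
  apply: measurable_funM => //.
  by apply: continuous_measurable_fun; exact: continuous_sin.
(* The majorant is used away from 0 only; the endpoint is restored as a null set. *)
have /integrableP[_ hi] : mu.-integrable `]0, pi / 2] (EFin \o h).
  have gi : mu.-integrable `]0, pi / 2] (EFin \o (fun t : R => 3 - ln t)).
    by apply: integrable_sub_ln; lra.
  apply: le_integrable gi => //; first exact: mh.
  move=> t; rewrite /= in_itv /= => tI; rewrite lee_fin.
  by apply: (le_trans (norm_ln_sin_le tI)); exact: ler_norm.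
apply/integrableP; split; first exact: mh.
rewrite -integral_itv_obnd_cbnd//.
exact: measurableT_comp.
Qed.

Lemma continuous_ln_sin (R : realType) (x : R) : 0 < x <= pi / 2 ->
  {for x, continuous (fun t : R => ln `|2 * sin t|)}.
Proof.
move=> /sin_doubled_gt0 s0.
suff: {for x, continuous (@ln R \o (Num.norm \o (fun t : R => 2 * sin t)))} by [].
apply: continuous_comp; last first.
  by apply: continuous_ln; rewrite /= normr_gt0 gt_eqF.
apply: continuous_comp; last exact: norm_continuous.
by apply: cvgM; [exact: cvg_cst|exact: continuous_sin].
Qed.

Lemma is_derive_lobachevsky (R : realType) (x : R) : 0 < x < pi / 2 ->
  is_derive x 1 (@lobachevsky R) (- ln (2 * sin x)).
Proof.
move=> /andP[x0 xp].
have xI : 0 < x <= pi / 2 by rewrite x0 ltW.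
have [d1 d2] := continuous_FTC1_closed xp (@integrable_ln_sin R) x0 (continuous_ln_sin xI).
rewrite -(gtr0_norm (sin_doubled_gt0 xI)) -d2.
apply: is_deriveN.
by rewrite derive1E; exact/derivableP.
Qed.

Lemma continuous_lobachevsky (R : realType) :
  {within `[0, pi / 2], continuous (@lobachevsky R)}%classic.
Proof.
have := @parameterized_integral_continuous R 0 (pi / 2) _ _ (@integrable_ln_sin R).
have -> : 0 <= (pi / 2 : R) by have := pi_gt0 R; lra.
move=> /(_ isT) H x; apply: cvgN; exact: H.
Qed.

Lemma lobachevsky0 (R : realType) : lobachevsky (0 : R) = 0.
Proof. by rewrite /lobachevsky set_itv1 Rintegral_set1 oppr0. Qed.

Lemma within_continuous_comp_into (U V W : topologicalType) (A : set U)
    (B : set V) (f : U -> V) (g : V -> W) :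
  continuous f -> (forall x, A x -> B (f x)) ->
  {within B, continuous g}%classic -> {within A, continuous (g \o f)}%classic.
Proof.
move=> cf AB /subspace_continuousP cg; apply/subspace_continuousP => x Ax.
apply: (@cvg_comp _ _ _ f g (within A (nbhs x)) (within B (nbhs (f x)))); last exact/cg/AB.
move=> P BP; have H : nbhs x (f @^-1` (fun y => B y -> P y))%classic := cf x _ BP.
change (nbhs x (fun y => A y -> P (f y))).
by apply: filterS H => y h Ay; apply: h; exact: AB.
Qed.

(** The difference of the two sides vanishes at 0 and has derivative cos (x/c) - cos x > 0. *)
Lemma sin_lt_mul_sin (R : realType) (c y : R) : 1 < c -> 0 < y <= pi / 2 ->
  sin y < c * sin (y / c).
Proof.
move=> c1 /andP[y0 yp].
have c0 : 0 < c by lra.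
have df (x : R) : is_derive x 1 (fun x : R => c * sin (x / c) - sin x) (cos (x / c) - cos x).
  have d1 : is_derive x 1 (fun x : R => x / c) (c^-1).
    by apply: is_derive_eq; rewrite /GRing.scale /=; ring.
  apply: is_derive_eq; rewrite /GRing.scale /=; field; lra.
have [|d dI E] := @MVT R (fun x : R => c * sin (x / c) - sin x)
    (fun x => cos (x / c) - cos x) 0 y y0 (fun x _ => df x).
  apply: continuous_subspaceT => x.
  by apply/differentiable_continuous/derivable1_diffP; have := df x.
move: E; rewrite mul0r sin0 mulr0 !subr0 -subr_gt0 => ->.
apply: mulr_gt0 => //; rewrite subr_gt0.
move: dI; rewrite in_itv /= => /andP[d0 dy].
have dc : d / c < d by rewrite ltr_pdivrMr // ltr_pMr.
have dc0 : 0 < d / c by exact: divr_gt0.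
by rewrite ltr_cos ?in_itv /=; have := pi_gt0 R; lra.
Qed.

Lemma lobachevsky_dilation (R : realType) (c x : R) : 1 < c -> 0 < x <= pi / 2 ->
  c * lobachevsky (x / c) - lobachevsky x < x * ln c.
Proof.
move=> c1 /andP[x0 xp].
have c0 : 0 < c by lra.
pose h (y : R) : R := c * lobachevsky (y / c) - lobachevsky y - y * ln c.
have yc y : 0 < y -> 0 < y / c < y.
  by move=> y0; rewrite divr_gt0//= ltr_pdivrMr // ltr_pMr.
have dh y : y \in `]0, x[ -> is_derive y 1 h
    (- ln (2 * sin (y / c)) + ln (2 * sin y) - ln c).
  rewrite in_itv /= => /andP[y0 yx].
  have /andP[yc0 ycy] := yc y y0.
  have d0 : is_derive y 1 (@lobachevsky R) (- ln (2 * sin y)).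
    by apply: is_derive_lobachevsky; lra.
  have d1 : is_derive y 1 (fun y : R => y / c) (c^-1).
    by apply: is_derive_eq; rewrite /GRing.scale /=; ring.
  have d2 : is_derive (y / c) 1 (@lobachevsky R) (- ln (2 * sin (y / c))).
    by apply: is_derive_lobachevsky; lra.
  apply: is_derive_eq; rewrite /GRing.scale /=; field; lra.
(* Only continuity is available at 0, where the derivative of [lobachevsky] blows up. *)
have ch : {within `[0, x], continuous h}%classic.
  move=> y; apply: cvgB; last first.
    apply: (@continuous_subspaceT R R `[0, x]%classic (fun y : R => y * ln c)) => {}y.
    by apply: cvgM; [exact: cvg_id|exact: cvg_cst].
  apply: cvgB.
    apply: cvgM; first exact: cvg_cst.
    apply: (@within_continuous_comp_into R R R `[0, x] `[0, pi / 2]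
      (fun y => y / c) (@lobachevsky R)) => [{}y|{}y|].
    - by apply: cvgM; [exact: cvg_id|exact: cvg_cst].
    - rewrite /= !in_itv /= => /andP[]; rewrite le_eqVlt => /orP[/eqP <- _|y0 yx].
        by rewrite mul0r lexx; have := pi_gt0 R; lra.
      by have := yc y y0; lra.
    - exact: continuous_lobachevsky.
  apply: continuous_subspaceW (@continuous_lobachevsky R) _ => z.
  by rewrite /= !in_itv /= => /andP[-> zx]; rewrite (le_trans zx).
have [d dI] := MVT x0 dh ch.
rewrite /h !mul0r lobachevsky0 mulr0 !subr0 => E.
rewrite -subr_lt0 E pmulr_llt0//.
move: dI; rewrite in_itv /= => /andP[d0 dx].
have dp : 0 < d <= pi / 2 by lra.
have /andP[dc0 dcd] := yc d d0.
have s1 := sin_doubled_gt0 dp.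
have s2 : 0 < 2 * sin (d / c) by apply: sin_doubled_gt0; lra.
have : ln (2 * sin d) < ln c + ln (2 * sin (d / c)).
  rewrite -lnM ?posrE// ltr_ln ?posrE//; last exact: mulr_gt0.
  by rewrite mulrCA ltr_pM2l//; exact: sin_lt_mul_sin.
lra.
Qed.

(* By the duplication formula, L(2y) - 2 L(y) + 2 L(pi/2 - y) is constant; compare
   y = 0 and y = pi/4. *)
Lemma lobachevsky_pihalf (R : realType) : lobachevsky (pi / 2 : R) = 0.
Proof.
have p0 := pi_gt0 R.
have p4 : 0 < (pi / 4 : R) by lra.
pose h (y : R) : R := lobachevsky (2 * y) - 2 * lobachevsky y
                      + 2 * lobachevsky (pi / 2 - y).
have dh y : y \in `]0, pi / 4[ -> is_derive y 1 h 0.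
  rewrite in_itv /= => /andP[y0 yp].
  have d0 : is_derive y 1 (@lobachevsky R) (- ln (2 * sin y)).
    by apply: is_derive_lobachevsky; lra.
  have d1 : is_derive y 1 (fun y : R => 2 * y) 2.
    by apply: is_derive_eq; rewrite /GRing.scale /=; ring.
  have d2 : is_derive (2 * y) 1 (@lobachevsky R) (- ln (2 * sin (2 * y))).
    by apply: is_derive_lobachevsky; lra.
  have d3 : is_derive y 1 (fun y : R => pi / 2 - y) (-1).
    by apply: is_derive_eq; ring.
  have d4 : is_derive (pi / 2 - y) 1 (@lobachevsky R) (- ln (2 * sin (pi / 2 - y))).
    by apply: is_derive_lobachevsky; lra.
  apply: is_derive_eq; rewrite /GRing.scale /=.
  have s1 : 0 < 2 * sin y by apply: sin_doubled_gt0; lra.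
  have s2 : 0 < 2 * sin (pi / 2 - y) by apply: sin_doubled_gt0; lra.
  have -> : 2 * sin (2 * y) = (2 * sin y) * (2 * sin (pi / 2 - y)).
    by rewrite sinB sin_pihalf cos_pihalf (mulr_natl y 2) sin_mulr2n; ring.
  rewrite lnM ?posrE//; ring.
have cL (f : R -> R) : continuous f ->
    (forall y, 0 <= y <= pi / 4 -> 0 <= f y <= pi / 2) ->
    {within `[0, pi / 4], continuous (@lobachevsky R \o f)}%classic.
  move=> cf fI; apply: within_continuous_comp_into cf _ (@continuous_lobachevsky R).
  by move=> y /=; rewrite !in_itv /=; exact: fI.
have ch : {within `[0, pi / 4], continuous h}%classic.
  move=> y; apply: cvgD; first apply: cvgB.
  - apply: (cL (fun y => 2 * y)) => [z|z zI]; last by lra.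
    by apply: cvgM; [exact: cvg_cst|exact: cvg_id].
  - apply: cvgM; first exact: cvg_cst.
    by apply: (cL id) => [z|z zI]; [exact: cvg_id|lra].
  - apply: cvgM; first exact: cvg_cst.
    apply: (cL (fun y => pi / 2 - y)) => [z|z zI]; last by lra.
    by apply: cvgB; [exact: cvg_cst|exact: cvg_id].
(* [h] equals 2 L(pi/2) at 0 and L(pi/2) at pi/4, so its constancy gives L(pi/2) = 0. *)
have [d dI] := MVT p4 dh ch.
rewrite mul0r /h mulr0 lobachevsky0 subr0.
have -> : pi / 2 - pi / 4 = pi / 4 :> R by field.
have -> : 2 * (pi / 4) = pi / 2 :> R by field.
lra.
Qed.

(** Strict concavity with zeros at 0 and pi/2. A nonpositive value at x would give, by the mean
    value theorem, a derivative <= 0 before x and >= 0 after it, whereas - ln (2 sin) strictly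
    decreases. *)
Lemma lobachevsky_gt0 (R : realType) (x : R) : 0 < x < pi / 2 -> 0 < lobachevsky x.
Proof.
move=> /andP[x0 xp]; rewrite ltNge; apply/negP => Lx.
have dL y : y \in `]0, pi / 2[ -> is_derive y 1 (@lobachevsky R) (- ln (2 * sin y)).
  by rewrite in_itv /=; exact: is_derive_lobachevsky.
have sub (a b y : R) : 0 <= a -> b <= pi / 2 -> y \in `]a, b[ -> y \in `]0, pi / 2[.
  by rewrite !in_itv /= => a0 bp; lra.
have cL (a b : R) : 0 <= a -> b <= pi / 2 -> {within `[a, b], continuous (@lobachevsky R)}%classic.
  move=> a0 bp; apply: continuous_subspaceW (@continuous_lobachevsky R) => y.
  by rewrite /= !in_itv /=; lra.
have [c + E1] := MVT x0 (fun y yI => dL y (sub _ _ _ (lexx 0) (ltW xp) yI))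
  (cL _ _ (lexx 0) (ltW xp)).
have [d + E2] := MVT xp (fun y yI => dL y (sub _ _ _ (ltW x0) (lexx _) yI))
  (cL _ _ (ltW x0) (lexx _)).
rewrite !in_itv /= => dI cI.
rewrite lobachevsky0 !subr0 in E1; rewrite lobachevsky_pihalf sub0r in E2.
have h1 : - ln (2 * sin c) <= 0 by rewrite -(pmulr_lle0 _ x0) -E1.
have h2 : 0 <= - ln (2 * sin d).
  by rewrite -(pmulr_lge0 _ (_ : 0 < pi / 2 - x)) -?E2; lra.
have s1 : 0 < 2 * sin c by apply: sin_doubled_gt0; lra.
have s2 : 0 < 2 * sin d by apply: sin_doubled_gt0; lra.
have : ln (2 * sin c) < ln (2 * sin d).
  by rewrite ltr_ln ?posrE// ltr_pM2l// ltr_sin ?in_itv /=; lra.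
lra.
Qed.

Lemma is_derive_ln_sin (R : realType) (x : R) : 0 < x <= pi / 2 ->
  is_derive x 1 (fun y : R => ln (2 * sin y)) (cos x / sin x).
Proof.
move=> /sin_doubled_gt0 s0.
have d1 : is_derive x 1 (fun y : R => 2 * sin y) (2 * cos x).
  by apply: is_derive_eq; rewrite /GRing.scale /=; ring.
have d2 := is_derive1_ln s0.
apply: is_derive_eq; rewrite /GRing.scale /=; field.
by apply: lt0r_neq0; lra.
Qed.

(* The trapezoidal rule underestimates the integral of the concave ln (2 sin x). *)
Lemma lobachevsky_trapezoid (R : realType) (a b : R) : 0 < a -> a < b -> b <= pi / 2 ->
  (b - a) * (ln (2 * sin a) + ln (2 * sin b)) / 2 <= lobachevsky a - lobachevsky b.
Proof.
move=> a0 ab bp.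
pose p (x : R) : R := ln (2 * sin x).
have dp x : a <= x <= b -> is_derive x 1 p (cos x / sin x).
  by move=> xI; apply: is_derive_ln_sin; lra.
have cp x y : a <= x -> y <= b -> {within `[x, y], continuous p}%classic.
  move=> ax yb; apply: continuous_in_subspaceT => z.
  rewrite inE /= in_itv /= => zI.
  by apply/differentiable_continuous/derivable1_diffP; have := dp z ltac:(lra).
(* The error of the rule as a function of the right end; it vanishes at [a], and its derivative is
   shown to be nonnegative. *)
pose h (x : R) : R := lobachevsky a - lobachevsky x - (x - a) * (p a + p x) / 2.
have dh x : x \in `]a, b[ ->
    is_derive x 1 h ((p x - p a - (x - a) * (cos x / sin x)) / 2).
  rewrite in_itv /= => /andP[ax xb].
  have d0 : is_derive x 1 (@lobachevsky R) (- p x).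
    by apply: is_derive_lobachevsky; lra.
  have d1 := dp x ltac:(lra).
  apply: is_derive_eq; rewrite /GRing.scale /=.
  by move: (cos x / sin x) => k; field.
have ch : {within `[a, b], continuous h}%classic.
  move=> y; apply: cvgB.
    apply: cvgB; first exact: cvg_cst.
    apply: continuous_subspaceW (@continuous_lobachevsky R) _ => z.
    by rewrite /= !in_itv /=; lra.
  apply: cvgM; last exact: cvg_cst.
  apply: cvgM.
    apply: (@continuous_subspaceT R R `[a, b]%classic (fun y : R => y - a)) => {}y.
    by apply: cvgB; [exact: cvg_id|exact: cvg_cst].
  by apply: cvgD; [exact: cvg_cst|apply: cp].
have [c + E] := MVT ab dh ch.
rewrite in_itv /= => /andP[ac cb].
have ha : h a = 0 by rewrite /h !subrr !mul0r subr0.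
have : 0 <= h b; last first.
  by rewrite /h subr_ge0.
rewrite ha subr0 in E; rewrite E.
apply: mulr_ge0; last by lra.
apply: mulr_ge0 => //; rewrite subr_ge0.
(* [p c - p a] is (c - a) times the cotangent at some d < c, and the cotangent decreases. *)
have [d + ->] := @MVT R p (fun x => cos x / sin x) a c ac
  (fun x xI => dp x ltac:(move: xI; rewrite in_itv /=; lra)) (cp _ _ (lexx a) (ltW cb)).
rewrite in_itv /= => /andP[ad dc].
rewrite mulrC ler_pM2r; last by lra.
have sd : 0 < 2 * sin d by apply: sin_doubled_gt0; lra.
have sc : 0 < 2 * sin c by apply: sin_doubled_gt0; lra.
have sdc : sin d < sin c by rewrite ltr_sin ?in_itv /=; lra.
have cc : 0 <= cos c by apply: cos_ge0_pihalf; lra.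
have cdc : cos c < cos d by rewrite ltr_cos ?in_itv /=; lra.
apply: ler_pM => //; try lra.
  by rewrite invr_ge0; lra.
by rewrite lef_pV2 ?posrE; lra.
Qed.

(* v_oct = 8 (L(pi/4) - L(pi/2)); two trapezoids, on [pi/4, 3pi/8] and
   [3pi/8, pi/2], give v_oct >= (pi/2) ln (4 + 4 sqrt 2) > (pi/2) ln 9. *)
Lemma v_oct_gt (R : realType) : pi * ln 3 < v_oct R.
Proof.
have p0 := pi_gt0 R.
have t1 := @lobachevsky_trapezoid R (pi / 4) (3 * pi / 8) ltac:(lra) ltac:(lra) ltac:(lra).
have t2 := @lobachevsky_trapezoid R (3 * pi / 8) (pi / 2) ltac:(lra) ltac:(lra) ltac:(lra).
rewrite lobachevsky_pihalf sin_pihalf mulr1 in t2.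
set r : R := 2 * sin (pi / 4) in t1 *.
set q : R := 2 * sin (3 * pi / 8) in t1 t2 *.
have r0 : 0 < r by apply: sin_doubled_gt0; lra.
have q0 : 0 < q by apply: sin_doubled_gt0; lra.
have r2 : r ^+ 2 = 2.
  have := cos_pihalf R.
  have {1}-> : pi / 2 = (pi / 4) *+ 2 :> R by rewrite -mulr_natr; field.
  rewrite cos_mulr2n cos2sin2 /r => H; lra.
have q2 : q ^+ 2 = 2 + r.
  have : cos ((3 * pi / 8) *+ 2) = - sin (pi / 4 : R).
    have -> : (3 * pi / 8) *+ 2 = pi / 4 + pi / 2 :> R by rewrite -mulr_natr; field.
    by rewrite cosDpihalf.
  rewrite cos_mulr2n cos2sin2 /q /r => H; lra.
(* Here r is the square root of 2, and r > 5/4 is exactly the condition 4 + 4 r > 9. *)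
have r54 : 5 / 4 < r by nra.
have key : 2 * ln 3 < ln r + ln q *+ 2 + ln 2 :> R.
  have -> : 2 * ln 3 = ln 9 :> R.
    have -> : 9 = 3 ^+ 2 :> R by ring.
    by rewrite lnXn // mulr_natl.
  have rq : 0 < r * (2 + r) by apply: mulr_gt0; lra.
  rewrite -lnXn// q2 -lnM ?posrE//; last by lra.
  rewrite -lnM ?posrE//.
  have -> : r * (2 + r) * 2 = 4 * r + 2 * r ^+ 2 by ring.
  by rewrite r2 ltr_ln ?posrE; lra.
rewrite /v_oct /vol_bipyramid.
have h : pi * (2 * ln 3) < pi * (ln r + ln q *+ 2 + ln 2) :> R by rewrite ltr_pM2l.
have e1 : (3 * pi / 8 - pi / 4) * (ln r + ln q) / 2 = (pi * ln r + pi * ln q) / 16 by field.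
have e2 : (pi / 2 - 3 * pi / 8) * (ln q + ln 2) / 2 = (pi * ln q + pi * ln 2) / 16 by field.
rewrite e1 in t1; rewrite e2 in t2.
rewrite mulrCA mulr2n !mulrDr in h.
lra.
Qed.

(** * Volumes of bipyramids *)

Lemma vol_bipyramid2 (R : realType) : vol_bipyramid R 2 = 0.
Proof. by rewrite /vol_bipyramid lobachevsky_pihalf mulr0. Qed.

Lemma pi_div_pihalf (R : realType) (n : nat) : (2 <= n)%N -> 0 < (pi / n%:R : R) <= pi / 2.
Proof.
move=> n2; have n0 : 0 < n%:R :> R by rewrite (@ltr0n R) (leq_trans _ n2).
by rewrite divr_gt0 ?pi_gt0//= ler_pM2l ?pi_gt0// lef_pV2 ?posrE// ler_nat.
Qed.

Lemma vol_bipyramid_gt0 (R : realType) (n : nat) : (3 <= n)%N -> 0 < vol_bipyramid R n.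
Proof.
move=> n3; have n0 : 0 < n%:R :> R by rewrite ltr0n (leq_trans _ n3).
rewrite /vol_bipyramid; apply: mulr_gt0; first by rewrite mulr_gt0.
apply: lobachevsky_gt0; rewrite divr_gt0 ?pi_gt0//= ltr_pM2l ?pi_gt0//.
by rewrite ltf_pV2 ?posrE// ltr_nat.
Qed.

Lemma vol_bipyramid_ge0 (R : realType) (n : nat) : (2 <= n)%N -> 0 <= vol_bipyramid R n.
Proof.
rewrite leq_eqVlt => /orP[/eqP<-|/(vol_bipyramid_gt0 R)/ltW//].
by rewrite vol_bipyramid2.
Qed.

Lemma vol_bipyramid_mul (R : realType) (s n : nat) : (2 <= s)%N -> (2 <= n)%N ->
  vol_bipyramid R (s * n) < vol_bipyramid R n + 2 * pi * ln s%:R.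
Proof.
move=> s2 n2; have n0 : 0 < n%:R :> R by rewrite (@ltr0n R) (leq_trans _ n2).
have s1 : 1 < s%:R :> R by rewrite ltr1n.
have := lobachevsky_dilation s1 (pi_div_pihalf R n2).
rewrite /vol_bipyramid natrM.
have -> : pi / (s%:R * n%:R) = pi / n%:R / s%:R :> R.
  by rewrite [s%:R * _]mulrC invfM mulrA.
set x := lobachevsky _; set y := lobachevsky _ => h.
have : 2 * n%:R * (s%:R * x - y) < 2 * n%:R * (pi / n%:R * ln s%:R).
  by rewrite ltr_pM2l// mulr_gt0.
have -> : 2 * n%:R * (pi / n%:R * ln s%:R) = 2 * pi * ln s%:R :> R.
  by field; rewrite gt_eqF.
lra.
Qed.

Lemma ln_succ_lt_v_oct (R : realType) (s : nat) : (2 <= s)%N ->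
  2 * pi * ln (s.+1%:R : R) < s%:R * v_oct R.
Proof.
move=> s2.
(* Equality holds at s = 2; the induction step uses (s + 2)^2 <= 3 (s + 1)^2. *)
have le_sq : (s.+1 ^ 2 <= 3 ^ s)%N.
  elim: s s2 => // s IHs; rewrite leq_eqVlt => /orP[/eqP[<-]//|s2].
  have {}IHs := IHs s2; rewrite (expnS 3).
  apply: (@leq_trans (3 * s.+1 ^ 2)%N); last by rewrite leq_mul2l.
  nia.
have : 2 * ln (s.+1%:R : R) <= s%:R * ln 3.
  rewrite !mulr_natl -!lnXn// ler_ln ?posrE ?exprn_gt0//.
  by rewrite -!natrX ler_nat.
have s0 : 0 < s%:R :> R by rewrite ltr0n (leq_trans _ s2).
have := v_oct_gt R; rewrite -(ltr_pM2l s0) => h1 h2.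
apply: le_lt_trans h1.
by rewrite mulrAC mulrC [s%:R * _]mulrCA ler_pM2l ?pi_gt0.
Qed.

(** * Volumes and entropy of the parallel graph *)

Section Volumes.
Import boot.fintype boot.finset.
Context (R : realType) (M : cmap).
Implicit Types d : dart M.

Lemma card_porbits_sum (T : finType) (p : {perm T}) :
  #|porbits p|%:R = \sum_x #|porbit p x|%:R^-1 :> R.
Proof.
rewrite -[LHS](sumr_const (mem (porbits p)) (1 : R)).
by rewrite (sum_porbits (fun=> 1 : R)); apply: eq_bigr => x _; rewrite mul1r.
Qed.

Lemma card_edges : #|porbits (edge M)|%:R = #|dart M|%:R / 2 :> R.
Proof.
rewrite card_porbits_sum (eq_bigr (fun=> 2^-1)) => [|d _]; last by rewrite card_porbit_edge.
by rewrite sumr_const mulr_natl.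
Qed.

Lemma vol_lozenge_sum :
  vol_lozenge R M = \sum_d vol_bipyramid R #|porbit (face M) d| / #|porbit (face M) d|%:R.
Proof. exact: sum_porbits. Qed.

Lemma vol_lozenge_dual :
  vol_lozenge R (dual M)
  = \sum_d vol_bipyramid R #|porbit (node M) d| / #|porbit (node M) d|%:R.
Proof.
rewrite /vol_lozenge sum_porbits.
rewrite (reindex_inj (@perm_inj _ (edge M))) /=.
by apply: eq_bigr => d _; rewrite card_porbit_dual_face.
Qed.

End Volumes.

Section ParallelVolumes.
Import boot.fintype boot.finset.
Context (R : realType) (M : cmap) (s : nat).

Lemma card_par_edges :
  #|porbits (edge (par_map s M))|%:R = s%:R * #|porbits (edge M)|%:R :> R.
Proof. by rewrite !card_edges card_prod card_ord natrM; field. Qed.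

Lemma card_par_vertices : (0 < s)%N -> #|porbits (node (par_map s M))| = #|porbits (node M)|.
Proof.
move=> s0; have cV (N : cmap) : #|{: vertex N}| = #|porbits (node N)| by rewrite card_sig.
by rewrite -!cV; exact: bij_eq_card (par_vertex_bij M s0).
Qed.

(** Only the last copy of a dart sees a face of [M]; the other copies bound bigons, of volume 0. *)
Lemma vol_lozenge_par : (0 < s)%N -> vol_lozenge R (par_map s M) = vol_lozenge R M.
Proof.
case: s => // m _; rewrite !vol_lozenge_sum.
rewrite (eq_bigr (fun a : dart M * 'I_m.+1 => (if a.2 == ord_max then
   vol_bipyramid R #|porbit (face M) a.1| / #|porbit (face M) a.1|%:R else 0))); last first.
  move=> a _; rewrite card_porbit_par_face.
  rewrite -(inj_eq val_inj) /= eqSS; case: ifP => // _.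
  by rewrite vol_bipyramid2 mul0r.
rewrite -(pair_bigA _ (fun d k => if k == ord_max then
   vol_bipyramid R #|porbit (face M) d| / #|porbit (face M) d|%:R else 0)) /=.
by apply: eq_bigr => d _; rewrite -big_mkcond big_pred1_eq.
Qed.

(** Each dart has s copies, each weighted by 1 over s times the old degree, so the factor s
    cancels. *)
Lemma vol_lozenge_dual_par : (0 < s)%N ->
  vol_lozenge R (dual (par_map s M))
  = \sum_(d : dart M) vol_bipyramid R (s * #|porbit (node M) d|) / #|porbit (node M) d|%:R.
Proof.
move=> s0; have sn0 : s%:R != 0 :> R by rewrite pnatr_eq0 -lt0n.
rewrite vol_lozenge_dual.
rewrite (eq_bigr (fun a : dart M * 'I_s => vol_bipyramid R (s * #|porbit (node M) a.1|)
   / (s%:R * #|porbit (node M) a.1|%:R))); last first.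
  by move=> a _; rewrite card_porbit_par_node natrM.
rewrite -(pair_bigA _ (fun d k => vol_bipyramid R (s * #|porbit (node M) d|)
   / (s%:R * #|porbit (node M) d|%:R))) /=.
apply: eq_bigr => d _; rewrite sumr_const card_ord -[LHS]mulr_natr.
have n0 : #|porbit (node M) d|%:R != 0 :> R by rewrite pnatr_eq0 card_porbit_neq0.
by field; rewrite sn0 n0.
Qed.

(** The bound of [vol_bipyramid_mul] is divided by the degree and summed over darts; [d0] makes the
    sum nonempty and so keeps it strict. *)
Lemma vol_lozenge_dual_par_lt (d0 : dart M) : (1 < s)%N -> two_connected (skeleton M) ->
  vol_lozenge R (dual (par_map s M))
  < vol_lozenge R (dual M) + 2 * pi * ln s%:R * #|porbits (node M)|%:R.
Proof.
move=> s1 M2; rewrite vol_lozenge_dual_par ?(ltnW s1)// vol_lozenge_dual card_porbits_sum.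
rewrite mulr_sumr -big_split /=; apply: ltr_sum => [|d _].
  by apply/hasP; exists d0; rewrite ?mem_index_enum.
have deg := two_connected_degree d M2.
have deg0 : 0 < #|porbit (node M) d|%:R :> R by rewrite ltr0n ltnW.
by rewrite -mulrDl ltr_pM2r ?invr_gt0//; exact: vol_bipyramid_mul.
Qed.

(* If all faces and vertices had degree 2, then |V| = |F| = |E|, against Euler. *)
Lemma nu_lozenge_numerator_gt0 (d0 : dart M) :
  two_connected (skeleton M) -> two_connected (skeleton (dual M)) ->
  (#|porbits (node M)| + #|porbits (face M)| = #|porbits (edge M)|)%N ->
  0 < vol_lozenge R M + vol_lozenge R (dual M).
Proof.
move=> M2 dM2 euler.
have degv d : (1 < #|porbit (node M) d|)%N by exact: two_connected_degree.
have degf d : (1 < #|porbit (face M) d|)%N by exact: (@two_connected_degree (dual M)).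
rewrite vol_lozenge_sum vol_lozenge_dual -big_split /=.
have term_ge0 n : (1 < n)%N -> 0 <= vol_bipyramid R n / n%:R.
  by move=> n1; rewrite divr_ge0 ?ler0n// vol_bipyramid_ge0.
have ge0 d : 0 <= vol_bipyramid R #|porbit (face M) d| / #|porbit (face M) d|%:R
   + vol_bipyramid R #|porbit (node M) d| / #|porbit (node M) d|%:R.
  by rewrite addr_ge0 ?term_ge0.
rewrite lt_neqAle sumr_ge0 ?andbT; last by move=> d _; exact: ge0.
rewrite eq_sym psumr_eq0 => [|d _]; last exact: ge0.
apply/negP => /allP all0.
have term_eq0 n : (1 < n)%N -> vol_bipyramid R n / n%:R = 0 -> n = 2.
  move=> n1 E; apply/eqP; rewrite eqn_leq n1 andbT leqNgt; apply/negP => n3.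
  have : 0 < vol_bipyramid R n / n%:R by rewrite divr_gt0 ?vol_bipyramid_gt0// ltr0n ltnW.
  by rewrite E ltxx.
have bigon d : #|porbit (face M) d| = 2 /\ #|porbit (node M) d| = 2.
  have /eqP := all0 d (mem_index_enum d); rewrite /= => /eqP.
  rewrite paddr_eq0 ?term_ge0// => /andP[/eqP f0 /eqP v0].
  by split; apply: term_eq0.
have : #|porbits (node M)|%:R + #|porbits (face M)|%:R = #|porbits (edge M)|%:R :> R.
  by rewrite -natrD euler.
(* Counted per dart, the left side receives 1/2 + 1/2 and the right side 1/2. *)
rewrite !card_porbits_sum -big_split /=.
rewrite (eq_bigr (fun=> 1 : R)) => [|d _]; last first.
  by have [-> ->] := bigon d; field.
rewrite [in RHS](eq_bigr (fun=> 2^-1 : R)) => [|d _]; last by rewrite card_porbit_edge.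
rewrite !sumr_const => /eqP; rewrite -subr_eq0 -mulrnBl mulrn_eq0.
have /card_gt0P : exists d, d \in dart M by exists d0.
rewrite lt0n => /negbTE -> /=; rewrite subr_eq0 => /eqP half; clear -half; lra.
Qed.

End ParallelVolumes.

(** * Tree counts on boxes and their limit *)

Section Entropy.
Local Open Scope classical_set_scope.
Context (R : realType) (G : lattice_graph) (s : nat).
Context (s0 : (0 < s)%N).

Definition tree_density (K : lattice_graph) (n : nat) : R :=
  ln (tau (Gamma K n))%:R / #|{: vertex K * ('I_n * 'I_n)}|%:R.

Lemma card_box_vertex (K : lattice_graph) n :
  #|{: vertex K * ('I_n * 'I_n)}| = (#|porbits (node K)| * (n * n))%N.
Proof. by rewrite !card_prod !card_ord card_sig. Qed.

Lemma tau_parallel n (r : vertex G * ('I_n * 'I_n)) :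
  tau (Gamma (parallel s G) n) = (tau (Gamma G n) * s ^ #|{: vertex G * ('I_n * 'I_n)}|.-1)%N.
Proof. exact: (tau_cover (box_cover n G s0) (Ordinal s0) r). Qed.

(** With m edges in the box and trees of N edges, the count is at most C(m, N) s^N, a single term of
    the binomial expansion of (1 + s)^m. *)
Lemma tau_parallel_le n (r : vertex G * ('I_n * 'I_n)) :
  (tau (Gamma (parallel s G) n) <= s.+1 ^ (#|dart G| * (n * n))./2)%N.
Proof.
rewrite (tau_parallel r); set N := _.-1.
apply: (@leq_trans (s.+1 ^ #|{: box_arc G n}|./2)%N); last first.
  by rewrite leq_exp2l ?ltnS// half_leq// card_box_arc.
apply: (@leq_trans ('C(#|{: box_arc G n}|./2, N) * s ^ N)%N).
  by rewrite leq_mul2r (tau_le_bin (Gamma G n) r) orbT.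
rewrite -[s.+1]add1n expnDn; set m := _./2.
(* With fewer than N edges the binomial coefficient is 0. *)
have [mN|Nm] := ltnP m N; first by rewrite bin_small.
rewrite (bigD1 (Ordinal (Nm : (N < m.+1)%N)))//= exp1n mul1n.
by rewrite leq_addr.
Qed.

Context (d0 : dart G).

Definition box_root n (n0 : (0 < n)%N) : vertex G * ('I_n * 'I_n) :=
  (tail d0, (Ordinal n0, Ordinal n0)).

Lemma card_vertices_gt0 : (0 < #|porbits (node G)|)%N.
Proof. by apply/card_gt0P; exists (porbit (node G) d0); exact: mem_porbits. Qed.

(** The last term comes from the exponent |V| - 1 in place of |V|. Positive density excludes n = 0
    and a vanishing tree count, where the conventions for division by 0 and ln 0 would intervene. *)
Lemma tree_density_parallel n : 0 < tree_density G n ->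
  tree_density (parallel s G) n = tree_density G n + ln s%:R
    - (#|porbits (node G)|%:R)^-1 * ln s%:R * (n%:R^-1 * n%:R^-1).
Proof.
rewrite {1}/tree_density => dpos.
have n0 : (0 < n)%N.
  rewrite lt0n; apply/eqP => n0; move: dpos.
  by rewrite card_box_vertex n0 !muln0 invr0 mulr0 ltxx.
have tpos : (0 < tau (Gamma G n))%N.
  rewrite lt0n; apply/eqP => t0; move: dpos.
  by rewrite t0 ln0// mul0r ltxx.
have spos : 0 < s%:R :> R by rewrite ltr0n.
have V0 := card_vertices_gt0.
have npos : n%:R != 0 :> R by rewrite pnatr_eq0 -lt0n.
have Vpos : #|porbits (node G)|%:R != 0 :> R by rewrite pnatr_eq0 -lt0n.
rewrite /tree_density !card_box_vertex (tau_parallel (box_root n0)) (card_par_vertices _ s0).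
rewrite card_box_vertex natrM natrX lnM ?posrE ?exprn_gt0 ?ltr0n// lnXn// -[ln s%:R *+ _]mulr_natr.
rewrite -subn1 natrB ?muln_gt0 ?V0 ?n0// !natrM.
by field; rewrite npos Vpos.
Qed.

Lemma tree_density_parallel_le n : (0 < n)%N ->
  tree_density (parallel s G) n
  <= #|porbits (edge G)|%:R / #|porbits (node G)|%:R * ln s.+1%:R.
Proof.
move=> n0; have V0 := card_vertices_gt0.
have npos : n%:R != 0 :> R by rewrite pnatr_eq0 -lt0n.
have Vpos : 0 < #|porbits (node G)|%:R :> R by rewrite ltr0n.
rewrite /tree_density card_box_vertex (card_par_vertices _ s0) !natrM.
rewrite ler_pdivrMr ?mulr_gt0 ?ltr0n//.
have -> : #|porbits (edge G)|%:R / #|porbits (node G)|%:R * ln s.+1%:R *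
    (#|porbits (node G)|%:R * (n%:R * n%:R)) = (#|dart G| * (n * n))%:R / 2 * ln s.+1%:R :> R.
  by rewrite card_edges !natrM; field; rewrite gt_eqF.
have le_tau := tau_parallel_le (box_root n0).
(* Without spanning trees the density is 0 by the convention ln 0 = 0. *)
have [->|tpos] := posnP (tau (Gamma (parallel s G) n)).
  by rewrite ln0// mulr_ge0 ?divr_ge0 ?ler0n// ln_ge0// ler1n.
apply: (@le_trans _ _ (ln (s.+1 ^ (#|dart G| * (n * n))./2)%:R)).
  by rewrite ler_ln ?posrE ?ltr0n ?expn_gt0// ler_nat.
rewrite natrX lnXn ?ltr0n// -[ln _ *+ _]mulr_natl ler_wpM2r ?ln_ge0 ?ler1n//.
by rewrite ler_pdivlMr// -natrM ler_nat muln2 -[leqRHS]odd_double_half leq_addl.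
Qed.

Lemma cvg_tree_density : 0 < entropy R G ->
  tree_density G n @[n --> \oo] --> entropy R G.
Proof.
move=> z0; apply: contrapT => dvg; move: z0.
have -> : entropy R G = 0; last by rewrite ltxx.
rewrite /entropy dvgP// => cv; apply: dvg; exact: cv.
Qed.

Lemma cvg_tree_density_parallel : 0 < entropy R G ->
  tree_density (parallel s G) n @[n --> \oo] --> entropy R G + ln s%:R.
Proof.
move=> z0; have cz := cvg_tree_density z0.
have ch : (n%:R^-1 : R) @[n --> \oo] --> (0 : R).
  by rewrite -(cvg_shiftS (fun n => n%:R^-1 : R)); exact: cvg_harmonic.
have : tree_density G n + ln s%:R
    - (#|porbits (node G)|%:R)^-1 * ln s%:R * (n%:R^-1 * n%:R^-1) @[n --> \oo]
    --> entropy R G + ln s%:R - (#|porbits (node G)|%:R)^-1 * ln s%:R * (0 * 0).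
  apply: cvgB; first by apply: cvgD cz (cvg_cst _).
  by apply: cvgM; [exact: cvg_cst|apply: cvgM].
(* The formula needs positive density, which holds eventually because the limit is positive. *)
rewrite !mulr0 subr0; apply: cvg_trans; apply: near_eq_cvg.
near=> n; rewrite tree_density_parallel//.
by near: n; exact: cvgr_gt cz _ z0.
Unshelve. all: by end_near. Qed.

Lemma entropy_parallel : 0 < entropy R G ->
  entropy R (parallel s G) = entropy R G + ln s%:R.
Proof. by move=> z0; apply: cvg_lim => //; exact: cvg_tree_density_parallel. Qed.

Lemma entropy_parallel_le : 0 < entropy R G ->
  entropy R (parallel s G) <= #|porbits (edge G)|%:R / #|porbits (node G)|%:R * ln s.+1%:R.
Proof.
move=> z0; apply: limr_le.
  by apply/cvg_ex; eexists; exact: cvg_tree_density_parallel.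
near=> n; apply: tree_density_parallel_le; near: n; exact: nbhs_infty_gt.
Unshelve. all: by end_near. Qed.

End Entropy.

Theorem theorem12 (R : realType) (G : lattice_graph) (s : nat)
    (planarG : planar_lattice_graph G)
    (G2 : two_connected (skeleton G))
    (dualG2 : two_connected (skeleton (dual G)))
    (s_ge2 : (2 <= s)%N) :
  nu_lozenge R G <= 2 * pi * entropy R G /\
  2 * pi * entropy R G <= nu_bar R G ->
  nu_lozenge R (parallel s G) < 2 * pi * entropy R (parallel s G) /\
  2 * pi * entropy R (parallel s G) < nu_bar R (parallel s G).
Proof.
move=> [nu_le _]; have s0 : (0 < s)%N by exact: ltnW.
have [_ euler _ _] := planarG.
(* Connectedness provides a vertex, and a vertex is a nonempty orbit of darts. *)
have [[[v] _] _ _] := G2; pose d0 := vertex_dart v.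
have V0 : 0 < #|porbits (node G)|%:R :> R by rewrite ltr0n (card_vertices_gt0 d0).
have pi2 : 0 < 2 * pi :> R by rewrite mulr_gt0// pi_gt0.
have z0 : 0 < entropy R G.
  rewrite -(pmulr_rgt0 _ pi2); apply: lt_le_trans nu_le.
  by rewrite divr_gt0// nu_lozenge_numerator_gt0.
have E0 : 0 < #|porbits (edge G)|%:R :> R.
  by rewrite ltr0n -euler addn_gt0 (card_vertices_gt0 d0).
split.
  rewrite entropy_parallel// mulrDr.
  (* The entropy side gains exactly 2 pi ln s, while [nu_lozenge] gains strictly less. *)
  apply: (@lt_le_trans _ _ (nu_lozenge R G + 2 * pi * ln s%:R)); last by rewrite lerD2r.
  rewrite /nu_lozenge card_par_vertices// ltr_pdivrMr// mulrDl divfK ?gt_eqF//.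
  rewrite vol_lozenge_par// -addrA ltrD2l.
  exact: vol_lozenge_dual_par_lt.
(* After the entropy bound, the positive factor |E| / |V| cancels and 2 pi ln (1 + s) < s v_oct
   remains. *)
apply: le_lt_trans
  (_ : 2 * pi * (#|porbits (edge G)|%:R / #|porbits (node G)|%:R * ln s.+1%:R) < _).
  by rewrite ler_pM2l// entropy_parallel_le.
rewrite /nu_bar card_par_edges card_par_vertices// mulrCA.
have -> : s%:R * #|porbits (edge G)|%:R * v_oct R / #|porbits (node G)|%:R
  = #|porbits (edge G)|%:R / #|porbits (node G)|%:R * (s%:R * v_oct R) by ring.
by rewrite ltr_pM2l ?divr_gt0// ln_succ_lt_v_oct.
Qed.
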